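(* Let $X$ be a smooth complex projective variety of complex dimension $m$ and $n\ge1$. For any $q=0,1,\dots,n-1$ and any integer $k$ in the interval $[(2m-1)q,\,2mn-q]$ there is an isomorphism of $\mathcal{S}_n$-modules $$E_q^k(X,n)\cong E_q^{2mn+2q(m-1)-k}(X,n).$$
   Context: $X$ is connected of complex dimension $m\ge 1$; $H^*(X)=H^*(X;\mathbb{Q})$; $w\in H^{2m}(X)$ is the fundamental class; $\Delta=w\otimes 1+\dots+1\otimes w\in H^*(X)\otimes H^*(X)\cong H^*(X^2)$ is the class of the diagonal. For $1\le i\ne j\le n$, $p_i^*:H^*(X)\to H^*(X^n)$ and $p_{ij}^*:H^*(X^2)\to H^*(X^n)$ are the pullbacks along the projections to the $i$-th, resp. $(i,j)$-th, factors. The Kriz model $E(X,n)$ is the graded-commutative algebra obtained from the exterior algebra with generators $G_{ij}$ ($1\le i\neq j\le n$), of degree $2m-1$, and coefficients in $H^*(X)^{\otimes n}=H^*(X^n)$, modulo the relations $$G_{ji}=G_{ij};\qquad p_j^*(x)G_{ij}=p_i^*(x)G_{ij}\ (i<j,\ x\in H^*(X));\qquad G_{ik}G_{jk}=G_{ij}G_{jk}-G_{ij}G_{ik}\ (i<j<k).$$ The differential $d$ is the derivation with $d|_{H^*(X)^{\otimes n}}=0$ and $d(G_{ij})=p_{ij}^*(\Delta)$. It is bigraded, $E(X,n)=\bigoplus_{k,q}E_q^k(X,n)$: the lower degree $q$ is the number of exterior generators, the upper degree $k$ is the total degree. The symmetric group $\mathcal{S}_n$ acts on $E(X,n)$ by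 algebra automorphisms: $$\sigma\big(p_1^*(x_{h_1})\cdots p_n^*(x_{h_n})G_{i_1j_1}\cdots G_{i_qj_q}\big)=p_{\sigma(1)}^*(x_{h_1})\cdots p_{\sigma(n)}^*(x_{h_n})G_{\sigma(i_1)\sigma(j_1)}\cdots G_{\sigma(i_q)\sigma(j_q)};$$ each $E_q^k(X,n)$ is stable under this action. *)

(* Defs.v *)
From HB Require Import structures.
From mathcomp Require Import all_boot all_order all_fingroup all_algebra all_field.
From mathcomp Require Import generic_quotient ring_quotient.
From mathcomp Require Import finmap boolp.
From mathcomp.multinomials Require Import monalg.

Set Implicit Arguments.
Unset Strict Implicit.
Unset Printing Implicit Defensive.

Import GRing.Theory.
Local Open Scope ring_scope.
Local Open Scope quotient_scope.

(** * Graded Poincare duality algebras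

    [H = \bigoplus_e gr e] plays the role of [H^*(X; Q)] for [X] connected,
    closed and oriented of real dimension [2 m], with [gr e = H^e(X; Q)] and
    [w] the fundamental class.  For [X] a smooth complex projective variety of
    complex dimension [m], [pd_duality] is Poincare duality. *)
Record poincare_duality_algebra (m : nat) (H : falgType rat)
    (gr : nat -> {vspace H}) (w : H) : Prop := PoincareDualityAlgebra {
  pd_full : (\sum_(e < (2 * m).+1) gr e)%VS = fullv;
  pd_direct : directv (\sum_(e < (2 * m).+1) gr e)%VS;
  pd_above : forall e, (2 * m < e)%N -> gr e = 0%VS;
  pd_mul : forall e f x y,
    x \in gr e -> y \in gr f -> x * y \in gr (e + f)%N;
  pd_comm : forall e f x y,
    x \in gr e -> y \in gr f -> x * y = (-1) ^+ (e * f) *: (y * x);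
  pd_connected : gr 0%N = <[1]>%VS;
  pd_fundamental_neq0 : w != 0;
  pd_fundamental : gr (2 * m)%N = <[w]>%VS;
  pd_duality : forall e x, (e <= 2 * m)%N -> x \in gr e ->
    (forall y, y \in gr (2 * m - e)%N -> x * y = 0) -> x = 0
}.

(** * The free unital associative Q-algebra on a set of letters

    It is the monoid algebra of the free monoid.  The product is locked, and
    the type is an alias, to keep unification from unfolding it. *)

Section FreeAlgebra.
Variable X : choiceType.
Local Notation M := {malg rat[fmonom X]}.

Definition free_algebra := M.
HB.instance Definition _ := Choice.on free_algebra.
HB.instance Definition _ := GRing.Zmodule.on free_algebra.
HB.instance Definition _ := GRing.Lmodule.on free_algebra.

Definition free_mul : free_algebra -> free_algebra -> free_algebra :=
  locked (fun a b => (a : M) * (b : M)).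

Lemma free_mulE (a b : free_algebra) : free_mul a b = (a : M) * (b : M).
Proof. by rewrite /free_mul -lock. Qed.

Fact free_mulA : associative free_mul.
Proof. by move=> a b c; rewrite !free_mulE mulrA. Qed.
Fact free_mul1r : left_id (1 : M) free_mul.
Proof. by move=> a; rewrite free_mulE mul1r. Qed.
Fact free_mulr1 : right_id (1 : M) free_mul.
Proof. by move=> a; rewrite free_mulE mulr1. Qed.
Fact free_mulDl : left_distributive free_mul +%R.
Proof. by move=> a b c; rewrite !free_mulE; apply: mulrDl. Qed.
Fact free_mulDr : right_distributive free_mul +%R.
Proof. by move=> a b c; rewrite !free_mulE; apply: mulrDr. Qed.
Fact free_1neq0 : (1 : M) != 0.
Proof. exact: oner_neq0. Qed.

HB.instance Definition _ := GRing.Zmodule_isNzRing.Build free_algebra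
  free_mulA free_mul1r free_mulr1 free_mulDl free_mulDr free_1neq0.

Fact malgC_central c (a : M) : a * malgC c = malgC c * a.
Proof.
rewrite [a]monalgE mulr_suml mulr_sumr; apply: eq_bigr => k _.
by rewrite !malgM_def !fgmulUU mul1m mulm1 mulrC.
Qed.

Fact free_scaleAl (c : rat) (a b : free_algebra) :
  c *: free_mul a b = free_mul (c *: a) b.
Proof. by rewrite !free_mulE; apply: (@scalerAl _ M). Qed.
HB.instance Definition _ := GRing.Lmodule_isLalgebra.Build rat free_algebra
  free_scaleAl.

Fact free_scaleAr (c : rat) (a b : free_algebra) :
  c *: free_mul a b = free_mul a (c *: b).
Proof.
have H (d : M) : c *: d = malgC c * d by rewrite mul_malgC.
rewrite !free_mulE; apply: (etrans (H _)).
by rewrite mulrA -malgC_central -mulrA -H.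
Qed.
HB.instance Definition _ := GRing.Lalgebra_isAlgebra.Build rat free_algebra
  free_scaleAr.

Definition letter (l : X) : free_algebra := << fmu l >>.

Lemma free_algebra_ind (P : free_algebra -> Prop) :
  P 0 -> P 1 -> (forall a b, P a -> P b -> P (a + b)) ->
  (forall c a, P a -> P (c *: a)) ->
  (forall l a, P a -> P (letter l * a)) -> forall a, P a.
Proof.
move=> P0 P1 PD PZ PM a; rewrite [a]monalgE.
elim/big_ind: _ => [||k _]; [exact: P0 | exact: PD | ].
have -> : << a@_k *g k >> = a@_k *: << k >> :> M.
  by rewrite -mul_malgC malgM_def fgmulUU mulr1 mul1m.
apply: PZ; case: k => k; elim: k => [|l k IHk].
  by rewrite -fmoneE; exact: P1.
suff -> : << FMonom (l :: k) >> = letter l * << FMonom k >> by exact: PM.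
rewrite [RHS]free_mulE malgM_def fgmulUU mulr1; congr << _ >>.
by apply/eqP; rewrite fmP fmM fmU.
Qed.

(* The algebra morphism extending [h]. *)
Section Lift.
Variables (B : algType rat) (h : X -> B).

Let hM (k : fmonom X) : B := \prod_(l <- k) h l.

Definition free_lift (a : free_algebra) : B := mmap (in_alg B) hM a.

Fact hM_mmorphism : mmorphism hM.
Proof. by split=> [k l|]; rewrite /hM ?fmM ?big_cat // fm1 big_nil. Qed.
HB.instance Definition _ := isMultiplicative.Build _ _ hM hM_mmorphism.

Fact free_lift_zmod : zmod_morphism free_lift.
Proof. exact: (@mmap_is_additive _ _ _ (in_alg B) hM). Qed.
HB.instance Definition _ := GRing.isZmodMorphism.Build free_algebra B free_lift
  free_lift_zmod.

Fact free_lift_monoid : monoid_morphism free_lift.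
Proof.
have [hMM hM1] : multiplicative (mmap (in_alg B) hM).
  apply: commr_mmap_is_multiplicative => g k l.
  by rewrite /GRing.comm /= mulr_algl mulr_algr.
by split=> [|a b]; [exact: hM1 | rewrite [a * b]free_mulE; exact: hMM].
Qed.
HB.instance Definition _ := GRing.isMonoidMorphism.Build free_algebra B free_lift
  free_lift_monoid.

Fact free_lift_scalable : scalable free_lift.
Proof. by move=> c a; rewrite /free_lift mmapZ /= mulr_algl. Qed.
HB.instance Definition _ := GRing.isScalable.Build rat free_algebra B *:%R free_lift
  free_lift_scalable.

Lemma free_lift_letter l : free_lift (letter l) = h l.
Proof. by rewrite /free_lift /letter mmapU /= scale1r mul1r /hM fmU big_seq1. Qed.

End Lift.

Lemma free_lift_unique (B : algType rat) (f g : {lrmorphism free_algebra -> B}) :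
  (forall l, f (letter l) = g (letter l)) -> f =1 g.
Proof.
move=> fg; apply: free_algebra_ind => [||a b IHa IHb|c a IHa|l a IHa].
- by rewrite !rmorph0.
- by rewrite !rmorph1.
- by rewrite !rmorphD /= IHa IHb.
- by rewrite !linearZZ /= IHa.
- by rewrite !rmorphM /= fg IHa.
Qed.

End FreeAlgebra.

(** * Quotient of a Q-algebra by a set of relations *)

Section Quotient.
Variables (T : algType rat) (rel : T -> T -> Prop).

(* The two-sided ideal generated by the [a - b] with [rel a b]. *)
Inductive rel_ideal : T -> Prop :=
| RelIdeal_gen a b : rel a b -> rel_ideal (a - b)
| RelIdeal_0 : rel_ideal 0
| RelIdeal_D a b : rel_ideal a -> rel_ideal b -> rel_ideal (a + b)
| RelIdeal_Ml a b : rel_ideal b -> rel_ideal (a * b)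
| RelIdeal_Mr a b : rel_ideal a -> rel_ideal (a * b).

Definition rel_ideal_pred : {pred T} :=
  fun a => `[< rel_ideal a >].

Lemma rel_idealP a : reflect (rel_ideal a) (a \in rel_ideal_pred).
Proof. exact: asboolP. Qed.

Fact rel_ideal_zmod : zmod_closed rel_ideal_pred.
Proof.
split=> [|a b /rel_idealP Ia /rel_idealP Ib]; apply/rel_idealP.
  exact: RelIdeal_0.
by rewrite -[- b]mulN1r; apply: RelIdeal_D => //; apply: RelIdeal_Ml.
Qed.
HB.instance Definition _ :=
  GRing.isZmodClosed.Build T rel_ideal_pred rel_ideal_zmod.

Definition quotient_algebra := @Quotient.quot T rel_ideal_pred.
Local Notation A := quotient_algebra.

HB.instance Definition _ := Choice.on A.
HB.instance Definition _ := EqQuotient.on A.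
HB.instance Definition _ := GRing.Zmodule.on A.

(* Locked for the same reason as [free_mul]; likewise below. *)
Definition class_of : T -> A := locked (fun a => \pi_A a).

Lemma class_ofP a b : reflect (rel_ideal (a - b)) (class_of a == class_of b).
Proof.
by rewrite /class_of -!lock; have <- := Quotient.idealrBE rel_ideal_pred a b; apply: rel_idealP.
Qed.

Lemma class_of_repr u : class_of (repr u) = u.
Proof. by rewrite /class_of -lock reprK. Qed.

Lemma class_ofD a b : class_of (a + b) = class_of a + class_of b.
Proof. by rewrite /class_of -!lock raddfD. Qed.

Lemma class_of0 : class_of 0 = 0.
Proof. by rewrite /class_of -lock raddf0. Qed.

Lemma repr_class_of a : rel_ideal (repr (class_of a) - a).
Proof. by apply/class_ofP; rewrite class_of_repr. Qed.

Lemma rel_ideal_eq a b : rel_ideal (a - b) -> class_of a = class_of b.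
Proof. by move/class_ofP/eqP. Qed.

Definition quotient_one : A := class_of 1.
Definition quotient_mul : A -> A -> A :=
  locked (fun u v => class_of (repr u * repr v)).
Definition quotient_scale : rat -> A -> A :=
  locked (fun c u => class_of (c *: repr u)).

Lemma quotient_mulE a b :
  quotient_mul (class_of a) (class_of b) = class_of (a * b).
Proof.
rewrite /quotient_mul -lock; apply: rel_ideal_eq.
rewrite -(addrNK (repr (class_of a) * b) (repr (class_of a) * _)) -mulrBr -addrA -mulrBl.
by apply: RelIdeal_D; [apply: RelIdeal_Ml | apply: RelIdeal_Mr];
  apply: repr_class_of.
Qed.

Lemma quotient_scaleE c a :
  quotient_scale c (class_of a) = class_of (c *: a).
Proof.
rewrite /quotient_scale -lock; apply: rel_ideal_eq; rewrite -scalerBr -mulr_algl.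
by apply: RelIdeal_Ml; apply: repr_class_of.
Qed.

Lemma class_ind (P : A -> Prop) : (forall a, P (class_of a)) -> forall u, P u.
Proof. by move=> h u; rewrite -[u]class_of_repr. Qed.

Fact quotient_mulA : associative quotient_mul.
Proof.
elim/class_ind=> a; elim/class_ind=> b; elim/class_ind=> c.
by rewrite !quotient_mulE mulrA.
Qed.

Fact quotient_mul1r : left_id quotient_one quotient_mul.
Proof. by elim/class_ind=> a; rewrite quotient_mulE mul1r. Qed.

Fact quotient_mulr1 : right_id quotient_one quotient_mul.
Proof. by elim/class_ind=> a; rewrite quotient_mulE mulr1. Qed.

Fact quotient_mulDl : left_distributive quotient_mul +%R.
Proof.
elim/class_ind=> a; elim/class_ind=> b; elim/class_ind=> c.
by rewrite -class_ofD !quotient_mulE -class_ofD mulrDl.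
Qed.

Fact quotient_mulDr : right_distributive quotient_mul +%R.
Proof.
elim/class_ind=> a; elim/class_ind=> b; elim/class_ind=> c.
by rewrite -class_ofD !quotient_mulE -class_ofD mulrDr.
Qed.

(* [pzRingType] rather than [nzRingType]: arbitrary relations may kill 1. *)
HB.instance Definition _ := GRing.Zmodule_isPzRing.Build A
  quotient_mulA quotient_mul1r quotient_mulr1
  quotient_mulDl quotient_mulDr.

Fact quotient_scaleA c d u :
  quotient_scale c (quotient_scale d u) = quotient_scale (c * d) u.
Proof. by elim/class_ind: u => a; rewrite !quotient_scaleE scalerA. Qed.

Fact quotient_scale1 : left_id 1 quotient_scale.
Proof. by elim/class_ind=> a; rewrite quotient_scaleE scale1r. Qed.

Fact quotient_scaleDr : right_distributive quotient_scale +%R.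
Proof.
move=> c; elim/class_ind=> a; elim/class_ind=> b.
by rewrite -class_ofD !quotient_scaleE -class_ofD scalerDr.
Qed.

Fact quotient_scaleDl u : {morph quotient_scale^~ u : c d / c + d}.
Proof.
by move=> c d; elim/class_ind: u => a; rewrite !quotient_scaleE -class_ofD scalerDl.
Qed.

HB.instance Definition _ := GRing.Zmodule_isLmodule.Build rat A
  quotient_scaleA quotient_scale1 quotient_scaleDr quotient_scaleDl.

Lemma class_of1 : class_of 1 = 1.
Proof. by []. Qed.

Lemma class_ofM a b : class_of (a * b) = class_of a * class_of b.
Proof. by rewrite -quotient_mulE. Qed.

Lemma class_ofZ c a : class_of (c *: a) = c *: class_of a.
Proof. by rewrite -quotient_scaleE. Qed.

Lemma class_of_rel a b : rel a b -> class_of a = class_of b.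
Proof. by move=> rab; apply: rel_ideal_eq; apply: RelIdeal_gen. Qed.

Lemma quotient_scaleAl c (u v : A) : c *: (u * v) = (c *: u) * v.
Proof.
elim/class_ind: u => a; elim/class_ind: v => b.
by rewrite -class_ofM -!class_ofZ -class_ofM scalerAl.
Qed.

Lemma quotient_scaleAr c (u v : A) : c *: (u * v) = u * (c *: v).
Proof.
elim/class_ind: u => a; elim/class_ind: v => b.
by rewrite -class_ofM -!class_ofZ -class_ofM scalerAr.
Qed.

End Quotient.

(** * The Kriz model *)

Section KrizModel.
Variables (m : nat) (H : falgType rat) (gr : nat -> {vspace H}) (n : nat).

(* [inl (i, x)] stands for [p_i^*(x)], [inr (i, j)] for [G_ij], [i != j]. *)
Definition kriz_letter : choiceType :=
  ('I_n * H + {ij : 'I_n * 'I_n | ij.1 != ij.2})%type.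

Local Notation T := (free_algebra kriz_letter).

Definition free_pull (i : 'I_n) (x : H) : T := letter (inl (i, x)).

(* There is no generator [G_ii]; the value 0 is a junk value. *)
Definition free_G (i j : 'I_n) : T :=
  if insub (i, j) is Some ij then letter (inr ij) else 0.

(* The first three families make each [p_i^*] a homomorphism of unital
   Q-algebras; together with graded commutativity between the images they
   present the graded tensor power [H^{\otimes n}]. *)
Inductive kriz_rel : T -> T -> Prop :=
| kriz_pull_linear i a x y :
    kriz_rel (free_pull i (a *: x + y)) (a *: free_pull i x + free_pull i y)
| kriz_pull1 i : kriz_rel (free_pull i 1) 1
| kriz_pullM i x y : kriz_rel (free_pull i (x * y)) (free_pull i x * free_pull i y)
| kriz_pull_comm i j e f x y : x \in gr e -> y \in gr f ->
    kriz_rel (free_pull i x * free_pull j y)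
             ((-1) ^+ (e * f) *: (free_pull j y * free_pull i x))
| kriz_pull_G_comm h i j e x : x \in gr e ->
    kriz_rel (free_pull h x * free_G i j)
             ((-1) ^+ (e * (2 * m - 1)) *: (free_G i j * free_pull h x))
| kriz_G_comm i j h l :
    kriz_rel (free_G i j * free_G h l)
             ((-1) ^+ ((2 * m - 1) * (2 * m - 1)) *: (free_G h l * free_G i j))
| kriz_G_sym i j : kriz_rel (free_G j i) (free_G i j)
| kriz_pull_G (i j : 'I_n) x : (i < j)%N ->
    kriz_rel (free_pull j x * free_G i j) (free_pull i x * free_G i j)
| kriz_arnold (i j k : 'I_n) : (i < j)%N -> (j < k)%N ->
    kriz_rel (free_G i k * free_G j k)
             (free_G i j * free_G j k - free_G i j * free_G i k).

Local Notation E := (quotient_algebra kriz_rel).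

Definition kriz_pull : 'I_n -> H -> E :=
  locked (fun i x => class_of kriz_rel (free_pull i x)).
Definition kriz_G : 'I_n -> 'I_n -> E :=
  locked (fun i j => class_of kriz_rel (free_G i j)).

Lemma kriz_pullE i x : kriz_pull i x = class_of kriz_rel (free_pull i x).
Proof. by rewrite /kriz_pull -lock. Qed.

Lemma kriz_GE i j : kriz_G i j = class_of kriz_rel (free_G i j).
Proof. by rewrite /kriz_G -lock. Qed.

(* [kriz_monomial q k u]: [u] is a product, in some order, of [q] exterior
   generators and of [p_i^*(x)]'s with [x] homogeneous, of total degree [k]. *)
Inductive kriz_monomial : nat -> nat -> E -> Prop :=
| kriz_monomial1 : kriz_monomial 0 0 1
| kriz_monomial_pull q k i e x u :
    x \in gr e -> kriz_monomial q k u ->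
    kriz_monomial q (e + k) (kriz_pull i x * u)
| kriz_monomial_G q k i j u :
    i != j -> kriz_monomial q k u ->
    kriz_monomial q.+1 (2 * m - 1 + k) (kriz_G i j * u).

(* The bigraded piece [E_q^k(X, n)]. *)
Definition kriz_bideg (q k : nat) (u : E) : Prop :=
  exists (N : nat) (c : 'I_N -> rat) (v : 'I_N -> E),
    (forall a, kriz_monomial q k (v a)) /\ u = \sum_(a < N) c a *: v a.

(** ** The action of the symmetric group *)

Definition kriz_perm_letter (s : 'S_n) (l : kriz_letter) : T :=
  match l with
  | inl (i, x) => free_pull (s i) x
  | inr ij => free_G (s (val ij).1) (s (val ij).2)
  end.

Definition free_act (s : 'S_n) : T -> T := free_lift (kriz_perm_letter s).
HB.instance Definition _ s :=
  GRing.RMorphism.copy (free_act s) (free_lift (kriz_perm_letter s)).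
HB.instance Definition _ s :=
  GRing.Linear.copy (free_act s) (free_lift (kriz_perm_letter s)).

(* Independent of the representative, see [kriz_act_class]. *)
Definition kriz_act (s : 'S_n) (u : E) : E :=
  class_of kriz_rel (free_act s (repr u)).

Lemma free_act_pull s i x : free_act s (free_pull i x) = free_pull (s i) x.
Proof. exact: free_lift_letter. Qed.

Lemma free_act_G s i j : free_act s (free_G i j) = free_G (s i) (s j).
Proof.
rewrite {1}/free_G; case: insubP => [ij _ vij|eq_ij].
  by rewrite [LHS]free_lift_letter /= vij.
rewrite /free_act raddf0 /free_G; case: insubP => // ij.
by rewrite /= (inj_eq perm_inj) => neq_ij; rewrite /= neq_ij in eq_ij.
Qed.

Lemma kriz_G_symE i j : kriz_G j i = kriz_G i j.
Proof. by rewrite !kriz_GE; apply: class_of_rel; apply: kriz_G_sym. Qed.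

Lemma kriz_pullG_E i j x :
  kriz_pull j x * kriz_G i j = kriz_pull i x * kriz_G i j.
Proof.
case: (ltngtP i j) => [ij|ji|/val_inj -> //].
  rewrite !kriz_pullE kriz_GE -!class_ofM.
  by apply: class_of_rel; apply: kriz_pull_G.
rewrite kriz_G_symE !kriz_pullE kriz_GE -!class_ofM.
by apply/esym/class_of_rel; apply: kriz_pull_G.
Qed.

Lemma kriz_G_commE i j h l : (0 < m)%N ->
  kriz_G i j * kriz_G h l = - (kriz_G h l * kriz_G i j).
Proof.
move=> m0; rewrite !kriz_GE -!class_ofM (class_of_rel (kriz_G_comm i j h l)) class_ofZ.
have odd_deg : odd (2 * m - 1) by case: (m) m0 => // d _; rewrite mulnS subn1 /= mul2n odd_double.
by rewrite -signr_odd oddM odd_deg scaleN1r.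
Qed.

(* The Arnold relation, in a form that is visibly S_n-stable. *)
Lemma kriz_arnoldE i j k : (0 < m)%N -> i != j -> j != k -> i != k ->
  kriz_G i j * kriz_G j k + kriz_G j k * kriz_G k i + kriz_G k i * kriz_G i j = 0.
Proof.
move=> m0.
pose cyc (a b c : 'I_n) : E :=
  kriz_G a b * kriz_G b c + kriz_G b c * kriz_G c a + kriz_G c a * kriz_G a b.
have cycr a b c : cyc a b c = cyc b c a.
  by rewrite /cyc -[LHS]addrA [LHS]addrC.
have cycs a b c : cyc b a c = - cyc a b c.
  rewrite /cyc (kriz_G_symE a b) (kriz_G_symE b c) (kriz_G_symE a c).
  rewrite (kriz_G_commE a b a c m0) (kriz_G_commE a c b c m0).
  rewrite (kriz_G_commE b c a b m0) -!opprD; congr (- _).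
  by rewrite addrC [X in _ + X]addrC addrA.
have cyc0 (a b c : 'I_n) : (a < b)%N -> (b < c)%N -> cyc a b c = 0.
  move=> ab bc; have := class_of_rel (kriz_arnold ab bc).
  rewrite class_ofD -[- (_ * _)]scaleN1r class_ofZ scaleN1r !class_ofM.
  rewrite -!kriz_GE => h.
  rewrite /cyc (kriz_G_symE a c) (kriz_G_commE b c a c m0).
  by rewrite (kriz_G_commE a c a b m0) h opprB addrCA subrr addr0 subrr.
have neq_lt (a b : 'I_n) : a != b -> (a < b)%N \/ (b < a)%N.
  by rewrite -val_eqE neq_ltn => /orP.
have swap (a b c : 'I_n) : cyc b a c = 0 -> cyc a b c = 0.
  by rewrite cycs => /eqP; rewrite oppr_eq0 => /eqP.
rewrite -/(cyc i j k) => /neq_lt[ij|ji] /neq_lt[jk|kj] /neq_lt[ik|ki].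
- exact: cyc0.
- by have := ltn_trans (ltn_trans ij jk) ki; rewrite ltnn.
- by rewrite 2!cycr; apply: swap; apply: cyc0.
- by rewrite 2!cycr; apply: cyc0.
- by apply: swap; apply: cyc0.
- by rewrite cycr; apply: cyc0.
- by have := ltn_trans (ltn_trans ji ik) kj; rewrite ltnn.
- by apply: swap; rewrite 2!cycr; apply: cyc0.
Qed.

Lemma free_act_rel s a b : (0 < m)%N -> kriz_rel a b ->
  class_of kriz_rel (free_act s a) = class_of kriz_rel (free_act s b).
Proof.
move=> m0; case=> [i c x y|i|i x y|i j e f x y xe yf|h i j e x xe|i j h l
  |i j|i j x ij|i j k ij jk].
- rewrite linearD linearZZ /= !free_act_pull.
  by apply: class_of_rel; apply: kriz_pull_linear.
- by rewrite rmorph1 free_act_pull; apply: class_of_rel; apply: kriz_pull1.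
- by rewrite rmorphM /= !free_act_pull; apply: class_of_rel; apply: kriz_pullM.
- rewrite linearZZ !rmorphM /= !free_act_pull.
  by apply: class_of_rel; apply: kriz_pull_comm.
- rewrite linearZZ !rmorphM /= free_act_pull free_act_G.
  by apply: class_of_rel; apply: kriz_pull_G_comm.
- rewrite linearZZ !rmorphM /= !free_act_G.
  by apply: class_of_rel; apply: kriz_G_comm.
- by rewrite !free_act_G; apply: class_of_rel; apply: kriz_G_sym.
- rewrite !rmorphM /= !free_act_G !free_act_pull.
  by rewrite !class_ofM -!kriz_pullE -kriz_GE kriz_pullG_E.
- rewrite rmorphB !rmorphM /= !free_act_G.
  rewrite class_ofD -[- (_ * _)]scaleN1r class_ofZ scaleN1r !class_ofM.
  rewrite -!kriz_GE.
  have neq (a' b' : 'I_n) : (a' < b')%N -> s a' != s b'.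
    by move=> ab; rewrite (inj_eq perm_inj) -val_eqE neq_ltn ab.
  have := kriz_arnoldE m0 (neq _ _ ij) (neq _ _ jk) (neq _ _ (ltn_trans ij jk)).
  rewrite (kriz_G_symE (s i) (s k)).
  rewrite (kriz_G_commE (s j) (s k) (s i) (s k) m0).
  rewrite (kriz_G_commE (s i) (s k) (s i) (s j) m0) addrAC => /eqP.
  by rewrite subr_eq0 => /eqP ->.
Qed.

Section Action.
Hypothesis m_gt0 : (0 < m)%N.

Lemma kriz_act_class s a :
  kriz_act s (class_of kriz_rel a) = class_of kriz_rel (free_act s a).
Proof.
apply: rel_ideal_eq; rewrite -linearB.
elim: (repr_class_of kriz_rel a) => [b c r||b c _ + _|b c _ +|b c _ +].
- by rewrite linearB; apply/class_ofP/eqP/free_act_rel.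
- by rewrite linear0; apply: RelIdeal_0.
- by rewrite linearD; apply: RelIdeal_D.
- by rewrite rmorphM; apply: RelIdeal_Ml.
- by rewrite rmorphM; apply: RelIdeal_Mr.
Qed.

Lemma kriz_act_linear s c u v :
  kriz_act s (c *: u + v) = c *: kriz_act s u + kriz_act s v.
Proof.
elim/class_ind: u => a; elim/class_ind: v => b.
rewrite -class_ofZ -class_ofD !kriz_act_class linearD linearZZ.
by rewrite class_ofD class_ofZ.
Qed.

Lemma kriz_act1 s : kriz_act s 1 = 1.
Proof. by rewrite -class_of1 kriz_act_class rmorph1. Qed.

Lemma kriz_actM s u v : kriz_act s (u * v) = kriz_act s u * kriz_act s v.
Proof.
elim/class_ind: u => a; elim/class_ind: v => b.
by rewrite -class_ofM !kriz_act_class rmorphM class_ofM.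
Qed.

Lemma kriz_act_pull s i x : kriz_act s (kriz_pull i x) = kriz_pull (s i) x.
Proof. by rewrite !kriz_pullE kriz_act_class free_act_pull. Qed.

Lemma kriz_act_G s i j : kriz_act s (kriz_G i j) = kriz_G (s i) (s j).
Proof. by rewrite !kriz_GE kriz_act_class free_act_G. Qed.

Lemma kriz_act_id u : kriz_act 1%g u = u.
Proof.
elim/class_ind: u => a; rewrite kriz_act_class; congr (class_of _ _).
elim/free_algebra_ind: a => [||a b IHa IHb|c a IHa|l a IHa].
- exact: linear0.
- exact: rmorph1.
- by rewrite linearD /= IHa IHb.
- by rewrite linearZZ /= IHa.
rewrite rmorphM /= IHa /free_act free_lift_letter; congr (_ * _).
by case: l => [[i x]|[[i j] ij]]; rewrite /= !perm1 // /free_G insubT.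
Qed.

(* A left action: the product [s * t] of permutations is [s] followed by [t]. *)
Lemma kriz_act_comp s t u : kriz_act (s * t)%g u = kriz_act t (kriz_act s u).
Proof.
elim/class_ind: u => a; rewrite !kriz_act_class; congr (class_of _ _).
elim/free_algebra_ind: a => [||a b IHa IHb|c a IHa|l a IHa].
- by rewrite !linear0.
- by rewrite !rmorph1.
- by rewrite !linearD /= IHa IHb.
- by rewrite !linearZZ /= IHa.
rewrite !rmorphM /= IHa; congr (_ * _).
rewrite /free_act !free_lift_letter -/(free_act t _).
by case: l => [[i x]|ij]; rewrite /= ?free_act_pull ?free_act_G !permM.
Qed.

Lemma kriz_bideg_act s q k u : kriz_bideg q k u -> kriz_bideg q k (kriz_act s u).
Proof.
case=> N [c [v [vP ->]]]; exists N, c, (fun a => kriz_act s (v a)); split.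
  move=> a; elim: (vP a) => [|q' k' i e x w xe _ IHw|q' k' i j w ij _ IHw].
  - by rewrite kriz_act1; apply: kriz_monomial1.
  - by rewrite kriz_actM kriz_act_pull; apply: kriz_monomial_pull.
  - rewrite kriz_actM kriz_act_G; apply: kriz_monomial_G => //.
    by rewrite (inj_eq perm_inj).
have act0 : kriz_act s 0 = 0.
  by rewrite -[in LHS](class_of0 kriz_rel) kriz_act_class linear0 class_of0.
elim/big_rec2: _ => [//|a y1 y2 _ <-].
by rewrite kriz_act_linear.
Qed.

End Action.

End KrizModel.

(* [f], given on all of [V], matters only through its restriction to [P]:
   a linear bijection from the subspace [P] onto the subspace [Q] commuting
   with the actions of [G]. *)
Definition equivariant_iso (G : Type) (V W : lmodType rat)
    (actV : G -> V -> V) (actW : G -> W -> W) (P : V -> Prop) (Q : W -> Prop) :=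
  exists f : V -> W,
  [/\ forall a u v, P u -> P v -> f (a *: u + v) = a *: f u + f v,
      forall u, P u -> Q (f u),
      forall u v, P u -> P v -> f u = f v -> u = v,
      forall v, Q v -> exists2 u, P u & f u = v
    & forall s u, P u -> f (actV s u) = actW s (f u)].

(* Main.v *)
(** Poincare duality of [H] gives a linear involution [flip] of [H] exchanging
    [H^e] and [H^(2m-e)].  It is not multiplicative, but it preserves parity, so
    it acts on the tensor powers of [H] compatibly with the Koszul signs.  In
    exterior degree [q] the Kriz model is the sum, over the partitions of
    {1..n} into [n - q] blocks, of one copy of [H] per block tensored with the
    forests spanning the blocks; applying [flip] in every block is the
    isomorphism.

    Only its well-definedness is an issue, since the model is given by
    generators and relations.  For each partition [r], let [p_i(x)] act on
    [H^{\otimes n} \otimes E] by multiplication in the position of the block of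
    [i], and [G_ij] by multiplication on [E] if [i], [j] share a block, and by
    [0] otherwise.  The relations hold for these operators, so [E] acts.  If
    [r] has [n - q] blocks, a product of [q] generators [G_ij] acts non-trivially
    on the unit vector only if its edges form a forest spanning the blocks of
    [r] (cyclic products vanish in [E] by the Arnold relation), so this orbit
    map reads off the [r]-component; apply [flip] in each block and multiply
    back into [E]. *)

From HB Require Import structures.
Require Import Defs.
From mathcomp Require Import all_boot all_order all_fingroup all_algebra all_field.
From mathcomp Require Import generic_quotient boolp functions.
From mathcomp Require Import zify.

Set Implicit Arguments.
Unset Strict Implicit.
Unset Printing Implicit Defensive.

Import GRing.Theory.
Local Open Scope ring_scope.

(** * Endomorphism algebras *)

Section LinearEndomorphisms.
Variables (R : comNzRingType) (V : lmodType R).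

Definition linear_endo_pred : {pred V -> V} := fun f => `[< linear f >].

Fact linear_endo_submod : submod_closed linear_endo_pred.
Proof.
split=> [|a f g /asboolP lf /asboolP lg]; apply/asboolP => c u v.
  by rewrite scaler0 addr0.
by rewrite !fctE /= lf lg !scalerDr !scalerA (mulrC c) addrACA.
Qed.
HB.instance Definition _ :=
  GRing.isSubmodClosed.Build R (V -> V) linear_endo_pred linear_endo_submod.

(* The non-vanishing of [V] makes the ring of endomorphisms non-trivial, as
   [algType] demands. *)
Record linear_endo (nzV : exists v : V, v != 0) := LinearEndo {
  linear_endo_val :> V -> V; _ : linear_endo_val \in linear_endo_pred }.

Variable nzV : exists v : V, v != 0.
Local Notation End := (linear_endo nzV).

HB.instance Definition _ := [isSub for @linear_endo_val nzV].
HB.instance Definition _ := [Choice of End by <:].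
HB.instance Definition _ := [SubChoice_isSubLmodule of End by <:].

Lemma linear_endoP (f g : End) : f =1 g -> f = g.
Proof. by move=> fg; apply/val_inj/funext. Qed.

Lemma linear_endo_linear (f : End) : linear f.
Proof. by case: f => f /= /asboolP. Qed.
HB.instance Definition _ (f : End) :=
  GRing.isLinear.Build R V V *:%R f (linear_endo_linear f).

Definition linear_endo_of f (lf : linear f) : End :=
  LinearEndo nzV (asboolT lf).

Fact id_linear : linear (@id V). Proof. by []. Qed.
Fact comp_linear (f g : End) : linear (f \o g).
Proof. by move=> c u v /=; rewrite !linearP. Qed.

Definition linear_endo1 := linear_endo_of id_linear.
Definition linear_endo_mul f g := linear_endo_of (comp_linear f g).

Lemma linear_endoD (f g : End) v : (f + g) v = f v + g v.
Proof. by []. Qed.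
Lemma linear_endoZ c (f : End) v : (c *: f) v = c *: f v.
Proof. by []. Qed.
Lemma linear_endo0 v : (0 : End) v = 0.
Proof. by []. Qed.

Fact linear_endo_mulA : associative linear_endo_mul.
Proof. by move=> f g h; apply: linear_endoP. Qed.
Fact linear_endo_mul1r : left_id linear_endo1 linear_endo_mul.
Proof. by move=> f; apply: linear_endoP. Qed.
Fact linear_endo_mulr1 : right_id linear_endo1 linear_endo_mul.
Proof. by move=> f; apply: linear_endoP. Qed.
Fact linear_endo_mulDl : left_distributive linear_endo_mul +%R.
Proof. by move=> f g h; apply: linear_endoP. Qed.
Fact linear_endo_mulDr : right_distributive linear_endo_mul +%R.
Proof. by move=> f g h; apply: linear_endoP => v /=; rewrite linearD. Qed.
Fact linear_endo1_neq0 : linear_endo1 != 0.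
Proof.
case: nzV => v; apply: contra_neq => h1.
by rewrite -[RHS](linear_endo0 v) -h1.
Qed.

HB.instance Definition _ := GRing.Zmodule_isNzRing.Build End
  linear_endo_mulA linear_endo_mul1r linear_endo_mulr1
  linear_endo_mulDl linear_endo_mulDr linear_endo1_neq0.

Fact linear_endo_scaleAl c (f g : End) : c *: (f * g) = (c *: f) * g.
Proof. by apply: linear_endoP. Qed.
HB.instance Definition _ :=
  GRing.Lmodule_isLalgebra.Build R End linear_endo_scaleAl.
Fact linear_endo_scaleAr c (f g : End) : c *: (f * g) = f * (c *: g).
Proof. by apply: linear_endoP => v; rewrite !linear_endoZ /= linearZZ. Qed.
HB.instance Definition _ :=
  GRing.Lalgebra_isAlgebra.Build R End linear_endo_scaleAr.

Lemma linear_endo1E v : (1 : End) v = v. Proof. by []. Qed.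
Lemma linear_endoM (f g : End) v : (f * g) v = f (g v).
Proof. by []. Qed.
End LinearEndomorphisms.

(** * Forests and their components *)

Section Representatives.
Variable n : nat.
Local Notation I := 'I_n.
Implicit Types (F : seq (I * I)) (i j s : I).

(** The larger of two representatives is redirected to the smaller, so that representatives remain
    least vertices. *)
Definition merge (a b s : I) : I :=
  let lo := if (a <= b)%N then a else b in
  let hi := if (a <= b)%N then b else a in
  if s == hi then lo else s.

(* [rep F s] is the least vertex of the connected component of [s] in the graph
   with edge list [F]. *)
Fixpoint rep F s : I :=
  if F is e :: F' then merge (rep F' e.1) (rep F' e.2) (rep F' s) else s.

(** Edges are added from the tail of the list: each must join two distinct components of the edges
    behind it, which also excludes loops and repetitions. *)
Fixpoint forest F : bool :=
  if F is e :: F' then (rep F' e.1 != rep F' e.2) && forest F' else true.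

Lemma merge_le a b s : (merge a b s <= s)%N.
Proof. by rewrite /merge /=; case: (leqP a b) => ab; case: eqP => [->|//]; lia. Qed.

Lemma merge_lr a b : merge a b a = merge a b b.
Proof.
by rewrite /merge /=; case: (leqP a b) => _; rewrite eqxx; case: eqP.
Qed.

Lemma merge_idem a b s : merge a b (merge a b s) = merge a b s.
Proof. by rewrite /merge /=; case: (s =P _) => [_|/eqP/negPf->//]; case: eqP. Qed.

Lemma merge_in a b s : merge a b s \in [:: a; b; s].
Proof.
rewrite /merge /= !inE.
by case: (leqP a b) => _; case: (s =P _) => _; rewrite eqxx ?orbT.
Qed.

Lemma merge_eq a b s : a != b ->
  (merge a b s == s) = (s != if (a <= b)%N then b else a).
Proof.
rewrite /merge /= => ab; case: (s =P _) => [->|_]; last exact: eqxx.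
by case: (leqP a b) => _; rewrite 1?[b == a]eq_sym (negPf ab).
Qed.

Lemma rep_le F s : (rep F s <= s)%N.
Proof. by elim: F => //= e F; apply: leq_trans; apply: merge_le. Qed.

Lemma rep_idem F s : rep F (rep F s) = rep F s.
Proof.
elim: F s => //= e F IH s; have := merge_in (rep F e.1) (rep F e.2) (rep F s).
set t := merge _ _ _ => tin; suff -> : rep F t = t by apply: merge_idem.
by move: tin; rewrite !inE => /or3P[] /eqP->; apply: IH.
Qed.

Lemma rep_edge F e : e \in F -> rep F e.1 = rep F e.2.
Proof.
elim: F => //= f F IH; rewrite inE => /predU1P[->|/IH->//].
exact: merge_lr.
Qed.

(** A merge sends one representative of an edge's ends to the other, and by induction [h] agrees on
    both. The target is an arbitrary type, so that [h] may also take values in an algebra. *)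
Lemma rep_const F (T : Type) (h : I -> T) :
  (forall e, e \in F -> h e.1 = h e.2) -> forall s, h (rep F s) = h s.
Proof.
elim: F => //= e F IH hF s; have {}IH t : h (rep F t) = h t.
  by apply: IH => f fF; apply: hF; rewrite inE fF orbT.
have he : h (rep F e.1) = h (rep F e.2) by rewrite !IH; apply: hF; apply: mem_head.
rewrite -[RHS]IH /merge; case: (leqP (rep F e.1) (rep F e.2)) => _.
  by case: (rep F s =P _) => // ->.
by case: (rep F s =P _) => // ->.
Qed.

Lemma card_rep F : forest F -> (#|[set s | rep F s == s]| + size F = n)%N.
Proof.
elim: F => [_|e F IH] /=.
  by rewrite addn0 (eq_card (B := I)) ?card_ord // => s; rewrite inE eqxx.
case/andP=> ab /IH cardF; apply: (etrans _ cardF).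
set a := rep F e.1 in ab *; set b := rep F e.2 in ab *.
(* The new edge removes exactly one representative, the larger of the two that it joins. *)
pose hi := if (a <= b)%N then b else a.
have hi_fix : hi \in [set s | rep F s == s].
  by rewrite inE /hi; case: ifP => _; apply/eqP; apply: rep_idem.
rewrite (cardsD1 hi [set s | rep F s == s]) hi_fix add1n addnS addSn.
congr (_ + _).+1; apply: eq_card => s.
rewrite !inE -merge_eq //; apply/eqP/andP=> [ms|[/eqP ms /eqP->]//].
suff rs : rep F s = s by rewrite rs in ms; rewrite ms rs !eqxx.
apply/val_inj/eqP; rewrite /= eqn_leq rep_le -[in X in (X <= _)%N]ms.
exact: merge_le.
Qed.

(** Such maps encode the set partitions of ['I_n]: idempotence together with [r s <= s] forces [r s]
    to be the least element of the block of [s]. *)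
Definition representatives (r : {ffun I -> I}) : bool :=
  [forall s, (r (r s) == r s) && (r s <= s)%N].

Lemma representativesP (r : {ffun I -> I}) :
  reflect ((forall s, r (r s) = r s) /\ (forall s, r s <= s)%N)
          (representatives r).
Proof.
apply: (iffP forallP) => [h|[h1 h2] s]; last by rewrite h1 eqxx h2.
by split=> s; case/andP: (h s) => // /eqP.
Qed.

Lemma rep_representatives F : representatives (finfun (rep F)).
Proof. by apply/representativesP; split=> s; rewrite !ffunE ?rep_idem ?rep_le. Qed.

(** A map [r] that respects the edges is coarser than [rep F]. With equally many blocks it is
    injective on the representatives of [F], so the two partitions coincide. *)
Lemma rep_unique F (r : {ffun I -> I}) :
    representatives r -> (forall e, e \in F -> r e.1 = r e.2) ->
    #|[set s | r s == s]| = #|[set s | rep F s == s]| ->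
  r = finfun (rep F).
Proof.
move=> /representativesP[r_idem r_le] /rep_const rF cardE.
have im_r : r @: [set s | rep F s == s] = [set s | r s == s].
  apply/setP=> s; apply/imsetP/idP=> [[t _ ->]|]; first by rewrite inE r_idem.
  by rewrite inE => /eqP rs; exists (rep F s); rewrite ?inE ?rep_idem ?rF.
have /imset_injP r_inj : #|r @: [set s | rep F s == s]| == #|[set s | rep F s == s]|.
  by rewrite im_r cardE.
apply/ffunP=> s; rewrite ffunE; apply/val_inj/eqP; rewrite /= eqn_leq.
apply/andP; split; first by rewrite -(rF s) r_le.
suff <- : rep F (r s) = rep F s by apply: rep_le.
by apply: r_inj; rewrite ?inE ?rep_idem // !rF r_idem.
Qed.

Definition adjacent F : rel I := [rel i j | ((i, j) \in F) || ((j, i) \in F)].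

Lemma rep_connect F i j : rep F i = rep F j -> connect (adjacent F) i j.
Proof.
have sym : connect_sym (adjacent F).
  by apply: sym_connect_sym => a b; rewrite /adjacent /= orbC.
have rootF e : e \in F -> fingraph.root (adjacent F) e.1 = fingraph.root (adjacent F) e.2.
  case: e => a b abF; apply/eqP; rewrite root_connect //.
  by apply: connect1; rewrite /adjacent /= abF.
move=> rij; rewrite -root_connect //.
by rewrite -(rep_const rootF i) rij (rep_const rootF).
Qed.

End Representatives.

(** * Normal forms in the Kriz model *)

Section SignedProducts.
Variables (R : comNzRingType) (E : algType R).

Lemma prod_commute_sign (J : eqType) (z : E) (y : J -> E) (e : nat) (d : J -> nat) l :
    {in l, forall j, z * y j = (-1) ^+ (e * d j) *: (y j * z)} ->
  z * \prod_(j <- l) y j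
    = (-1) ^+ (e * (\sum_(j <- l) d j)%N) *: (\prod_(j <- l) y j * z).
Proof.
elim: l => [_|j l IH zy].
  by rewrite !big_nil muln0 expr0 scale1r mul1r mulr1.
have {}IH := IH (fun i il => zy i (mem_behead (s := j :: l) il)).
rewrite !big_cons mulrA zy ?mem_head // -scalerAl -[y j * z * _]mulrA IH -scalerAr scalerA -exprD.
by rewrite -mulnDr mulrA.
Qed.

(* The sign depends on the degrees [d] only, not on the factors. *)
Lemma perm_prod_sign (J : eqType) (d : J -> nat) (l l' : seq J) : perm_eq l l' ->
  exists b : nat, forall y : J -> E,
    (forall i j, y i * y j = (-1) ^+ (d i * d j) *: (y j * y i)) ->
  \prod_(j <- l) y j = (-1) ^+ b *: \prod_(j <- l') y j.
Proof.
elim: l l' => [|i l IH] l' pl.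
  have /perm_nilP -> : perm_eq l' [::] by rewrite perm_sym.
  by exists 0%N => y _; rewrite scale1r.
have il' : i \in l' by rewrite -(perm_mem pl) mem_head.
case/splitPr: il' pl => l1 l2; rewrite -[i :: l2]cat1s perm_sym perm_catCA /=.
rewrite perm_cons perm_sym => /IH[b hb].
exists (b + d i * (\sum_(j <- l1) d j))%N => y yy.
rewrite big_cons (hb y yy) -scalerAr !big_cat big_cons [in LHS]mulrA /=.
by rewrite (prod_commute_sign (in1W (yy i))) -scalerAl scalerA -exprD mulrA.
Qed.

End SignedProducts.

(* The relations of the Kriz model, in S_n-symmetric form: the odd degree
   [2 m - 1] of the [G i j] has been replaced by [1]. *)
Record kriz_family (H : falgType rat) (gr : nat -> {vspace H}) (n : nat)
    (E : algType rat) (p : 'I_n -> H -> E) (G : 'I_n -> 'I_n -> E) : Prop :=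
  KrizFamily {
  kf_linear : forall i, linear (p i);
  kf_pull1 : forall i, p i 1 = 1;
  kf_pullM : forall i x y, p i (x * y) = p i x * p i y;
  kf_pull_comm : forall i j e f x y, x \in gr e -> y \in gr f ->
    p i x * p j y = (-1) ^+ (e * f) *: (p j y * p i x);
  kf_pull_G_comm : forall h i j e x, x \in gr e ->
    p h x * G i j = (-1) ^+ e *: (G i j * p h x);
  kf_G_comm : forall i j h l, G i j * G h l = - (G h l * G i j);
  kf_G_sym : forall i j, G j i = G i j;
  kf_G_diag : forall i, G i i = 0;
  kf_pull_G : forall i j x, p j x * G i j = p i x * G i j;
  kf_arnold : forall i j k, i != j -> j != k -> i != k ->
    G i j * G j k + G j k * G k i + G k i * G i j = 0 }.

Section KrizFamilyTheory.
Variables (H : falgType rat) (gr : nat -> {vspace H}) (n : nat).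
Variables (E : algType rat) (p : 'I_n -> H -> E) (G : 'I_n -> 'I_n -> E).
Hypothesis kf : kriz_family gr p G.
Local Notation I := 'I_n.
Implicit Types F : seq (I * I).

Definition Gprod F : E := \prod_(e <- F) G e.1 e.2.

Lemma Gprod_cons e F : Gprod (e :: F) = G e.1 e.2 * Gprod F.
Proof. exact: big_cons. Qed.

Lemma kf_G_sqr i j : G i j * G i j = 0.
Proof.
have := kf_G_comm kf i j i j; move/eqP; rewrite -addr_eq0 -mulr2n -scaler_nat.
by rewrite scaler_eq0 => /orP[|/eqP].
Qed.

Lemma Gprod_rem e F : e \in F ->
  exists c : rat, Gprod F = c *: (G e.1 e.2 * Gprod (rem e F)).
Proof.
elim: F => //= f F IH; rewrite inE; case: (f =P e) => [->|/eqP nfe] /=.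
  by exists 1; rewrite scale1r Gprod_cons.
rewrite eq_sym (negPf nfe) /= => /IH[c Fc]; exists (- c).
rewrite !Gprod_cons Fc -scalerAr !mulrA (kf_G_comm kf f.1) -!mulrA mulNr.
by rewrite scalerN scaleNr mulrA.
Qed.

(* Contract the first edge of the path: by the Arnold relation,
   [G i j * G i a] is a multiple of [G a j], and [a], [j] are joined by a path
   in the remaining edges. *)
Lemma Gprod_path F i l : uniq (i :: l) -> l != [::] ->
  path (adjacent F) i l -> G i (last i l) * Gprod F = 0.
Proof.
elim: l F i => // a l IH F i /= /and3P[]; rewrite inE negb_or => /andP[ia il] al ul _.
case/andP=> adj_ia pal.
have [e [eF Ge]] : exists e, e \in F /\ (G e.1 e.2 = G i a /\ ((e == (i, a)) || (e == (a, i)))).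
  case/orP: adj_ia => h; [exists (i, a) | exists (a, i)]; split=> //=.
    by rewrite eqxx.
  by rewrite (kf_G_sym kf) eqxx orbT.
case: Ge => Ge eE; have [c ->] := Gprod_rem eF; rewrite Ge.
rewrite -scalerAr mulrA.
case: l => [|b l] in IH il al ul pal *.
  by rewrite /= kf_G_sqr mul0r scaler0.
(* The path is simple, so from [a] on it avoids every edge at [i], in particular the one taken out
   of [F]. *)
have pal' : path (adjacent (rem e F)) a (b :: l).
  apply: (sub_in_path (P := [pred v | v != i])) pal => [u v /= ui vi|].
    have memF g : g.1 != i -> g.2 != i -> g \in F -> g \in rem e F.
      move=> g1 g2; rewrite (perm_mem (perm_to_rem eF)) inE => /orP[/eqP ge|//].
      by case/orP: eE => /eqP ee; move: g1 g2; rewrite ge ee /= eqxx.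
    by case/orP=> uvF; apply/orP; [left | right]; apply: memF.
  apply/allP => v; rewrite in_cons => /predU1P[->|vl]; rewrite /= 1?eq_sym //.
  by apply: contraNneq il => ->.
have aj := IH (rem e F) a.
set j := last a _ in aj *.
have jbl : j \in b :: l by exact: (mem_last b l).
have ij : i != j by apply: contraNneq il => ->.
have aj' : a != j by apply: contraNneq al => ->.
have {}aj : G a j * Gprod (rem e F) = 0.
  by apply: aj => //=; apply/andP.
have /eqP := kf_arnold kf ia aj' ij.
rewrite [G j i](kf_G_sym kf) addrC addr_eq0 => /eqP GG.
by rewrite GG mulNr mulrDl -!mulrA aj [G a j * _]mulrA (kf_G_comm kf a) mulNr -mulrA aj
           !(mulr0, oppr0, addr0, scaler0).
Qed.

Lemma Gprod_rep F i j : rep F i = rep F j -> G i j * Gprod F = 0.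
Proof.
move=> /rep_connect/connectP[l pl ->]; case/shortenP: pl => l' pl' ul' _.
case: l' => [|a l'] in pl' ul' *; first by rewrite (kf_G_diag kf) mul0r.
exact: Gprod_path.
Qed.

(** An edge that closes a cycle has both ends in one component of the edges behind it, where
    [Gprod_rep] applies. *)
Lemma Gprod_nforest F : ~~ forest F -> Gprod F = 0.
Proof.
elim: F => //= e F IH; rewrite negb_and negbK Gprod_cons => /orP[/eqP|/IH->].
  exact: Gprod_rep.
exact: mulr0.
Qed.

(** The relation [kf_pull_G] slides [x] along one edge, and [rep_const] then along a whole
    component. Homogeneity of [x] provides the sign for passing the edges in front. *)
Lemma pull_Gprod_rep F i e x : x \in gr e ->
  p (rep F i) x * Gprod F = p i x * Gprod F.
Proof.
move=> xe; apply: (rep_const (h := fun i => p i x * Gprod F)) => {i}.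
elim: F => //= f F IH g; rewrite inE Gprod_cons => /predU1P[->|/IH gF].
  by rewrite !mulrA (kf_pull_G kf).
by rewrite !mulrA !(kf_pull_G_comm kf _ _ _ xe) -!scalerAl -!mulrA gF.
Qed.

(* Normal form of the monomials, for [forest F] and [y] supported on the
   representatives of the components of [F]. *)
Definition nf F (y : I -> H) : E := \prod_s p s (y s) * Gprod F.

Definition supported F (y : I -> H) (d : I -> nat) :=
  (forall s, y s \in gr (d s)) /\
  (forall s, rep F s != s -> y s = 1 /\ d s = 0%N).

Lemma pull_prod_comm i e x (y : I -> H) (d : I -> nat) (l : seq I) :
    x \in gr e -> (forall s, y s \in gr (d s)) ->
  p i x * \prod_(s <- l) p s (y s)
    = (-1) ^+ (e * (\sum_(s <- l) d s)%N) *: (\prod_(s <- l) p s (y s) * p i x).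
Proof.
move=> xe yd; apply: prod_commute_sign => s _; exact: (kf_pull_comm kf _ _ xe (yd s)).
Qed.

Lemma pull_nf_rep F t e x y (d : I -> nat) : x \in gr e ->
  (forall s, y s \in gr (d s)) -> p t x * nf F y = p (rep F t) x * nf F y.
Proof.
move=> xe yd; rewrite /nf !mulrA !(pull_prod_comm _ _ xe yd) -!scalerAl -!mulrA.
by rewrite (pull_Gprod_rep _ _ xe).
Qed.

Hypothesis gr_mul : forall e f x y, x \in gr e -> y \in gr f -> x * y \in gr (e + f)%N.
Hypothesis gr_1 : 1 \in gr 0.

Lemma pull_prod t e x y (d : I -> nat) : x \in gr e ->
    (forall s, y s \in gr (d s)) ->
  exists c : rat, p t x * \prod_s p s (y s)
    = c *: \prod_s p s (if s == t then x * y s else y s).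
Proof.
move=> xe yd; have := index_enum_uniq I.
case/splitPr: (mem_index_enum t) => l1 l2; rewrite cat_uniq /= negb_or.
case/and3P=> _ /andP[tl1 _] /andP[tl2 _].
exists ((-1) ^+ (e * (\sum_(s <- l1) d s)%N)).
rewrite !big_cat !big_cons /= eqxx (kf_pullM kf) mulrA (pull_prod_comm _ _ xe yd).
rewrite -scalerAl !mulrA; congr (_ *: (_ * _ * _ * _)); apply: eq_big_seq => s sl.
  by case: eqP sl tl1 => [->->|].
by case: eqP sl tl2 => [->->|].
Qed.

(** Every factor slides to the representative of its component and is multiplied into the label
    there; the Koszul signs go into [c]. *)
Lemma prod_pull_normal F (l : seq (I * H * nat)) :
    {in l, forall z, z.1.2 \in gr z.2} ->
  exists (c : rat) (y : I -> H) (d : I -> nat),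
  [/\ supported F y d, (\sum_s d s = \sum_(z <- l) z.2)%N
    & \prod_(z <- l) p z.1.1 z.1.2 * Gprod F = c *: nf F y].
Proof.
elim: l => [_|[[t x] e] l IH lgr].
  exists 1, (fun=> 1), (fun=> 0%N); split; first by split=> // s; apply: gr_1.
    by rewrite big_nil big1.
  by rewrite /nf big_nil scale1r big1 // => s _; apply: (kf_pull1 kf).
have [z zl|c [y [d [[yd y1] sum_d Fy]]]] := IH; first by apply/lgr/mem_behead.
have xe : x \in gr e by apply: (lgr (t, x, e)); apply: mem_head.
have [c' ty] := pull_prod (rep F t) xe yd.
exists (c * c'), (fun s => if s == rep F t then x * y s else y s),
  (fun s => if s == rep F t then (e + d s)%N else d s); split.
- split=> s; first by case: eqP => // _; apply: gr_mul.
  by case: (s =P rep F t) => [->|_]; [rewrite rep_idem eqxx | apply: y1].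
- rewrite big_cons -sum_d (bigD1 (rep F t)) //= [in RHS](bigD1 (rep F t)) //= eqxx.
  by rewrite -addnA; congr (_ + (_ + _))%N; apply: eq_bigr => s /negPf->.
- rewrite big_cons /= -mulrA Fy -scalerAr (pull_nf_rep _ _ xe yd) {1}/nf mulrA ty.
  by rewrite -scalerAl scalerA.
Qed.

Variable m : nat.

Definition monomial q k (u : E) :=
  exists (c : rat) (l : seq (I * H * nat)) F,
  [/\ {in l, forall z, z.1.2 \in gr z.2}, size F = q,
      ((2 * m - 1) * q + \sum_(z <- l) z.2 = k)%N
    & u = c *: (\prod_(z <- l) p z.1.1 z.1.2 * Gprod F)].

Lemma monomial1 : monomial 0 0 1.
Proof.
exists 1, [::], [::]; split=> //; first by rewrite big_nil muln0.
by rewrite /Gprod !big_nil mulr1 scale1r.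
Qed.

Lemma monomial_pull q k i e x u : x \in gr e -> monomial q k u ->
  monomial q (e + k) (p i x * u).
Proof.
move=> xe [c [l [F [lgr sF <- ->]]]]; exists c, ((i, x, e) :: l), F; split=> //.
- by move=> z; rewrite inE => /predU1P[->|/lgr].
- by rewrite big_cons /= addnCA.
- by rewrite big_cons /= -scalerAr mulrA.
Qed.

Lemma monomial_G q k i j u : monomial q k u ->
  monomial q.+1 (2 * m - 1 + k) (G i j * u).
Proof.
move=> [c [l [F [lgr sF <- ->]]]].
exists (c * (-1) ^+ (1 * (\sum_(z <- l) z.2))%N), l, ((i, j) :: F); split=> //.
- by rewrite /= sF.
- by rewrite mulnS addnA.
rewrite -scalerAr Gprod_cons -scalerA; congr (_ *: _); rewrite [in LHS]mulrA.
suff -> : G i j * \prod_(z <- l) p z.1.1 z.1.2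
    = (-1) ^+ (1 * (\sum_(z <- l) z.2)%N) *: (\prod_(z <- l) p z.1.1 z.1.2 * G i j).
  by rewrite -scalerAl -mulrA.
apply: prod_commute_sign => z zl; rewrite mul1n (kf_pull_G_comm kf _ _ _ (lgr z zl)).
by rewrite scalerA -exprD -signr_odd addnn odd_double scale1r.
Qed.

Lemma monomial_nf q k u : monomial q k u ->
  u = 0 \/ exists (c : rat) F y d,
  [/\ forest F, size F = q, supported F y d,
      ((2 * m - 1) * q + \sum_s d s = k)%N & u = c *: nf F y].
Proof.
case=> c [l [F [lgr sF <- ->]]]; case: (boolP (forest F)) => [fF|/Gprod_nforest->].
  right; have [c' [y [d [yd sum_d ->]]]] := prod_pull_normal F lgr.
  by exists (c * c'), F, y, d; split; rewrite ?sum_d ?scalerA.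
by left; rewrite mulr0 scaler0.
Qed.

End KrizFamilyTheory.

(** * The duality involution *)

Section BasisTransfer.
Variables (K : fieldType) (V : vectType K).

Definition basis_transfer k (X : k.-tuple V) (Y : seq V) (x : V) : V :=
  \sum_(i < k) coord X i x *: Y`_i.

Fact basis_transfer_linear k X Y : linear (@basis_transfer k X Y).
Proof.
move=> c u v; rewrite /basis_transfer scaler_sumr -big_split; apply: eq_bigr => i _.
by rewrite linearP /= scalerDl scalerA.
Qed.
HB.instance Definition _ k X Y :=
  GRing.isLinear.Build K V V *:%R (@basis_transfer k X Y) (basis_transfer_linear X Y).

Lemma basis_transferK k l (X : k.-tuple V) (Y : l.-tuple V) x :
  k = l -> free Y -> x \in <<X>>%VS -> basis_transfer Y X (basis_transfer X Y x) = x.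
Proof.
move=> kl; case: l / kl Y => Y fY xX; rewrite [RHS](coord_span xX).
by apply: eq_bigr => i _; rewrite coord_sum_free.
Qed.
End BasisTransfer.

Section GradedAlgebra.
Variables (m : nat) (H : falgType rat) (gr : nat -> {vspace H}) (w : H).
Hypothesis pd : poincare_duality_algebra m gr w.
Local Notation d := (2 * m).+1.

Definition hproj (e : 'I_d) : H -> H := sumv_pi (\sum_(e < d) gr e)%VS e.
HB.instance Definition _ e := GRing.Linear.on (hproj e).

Lemma hproj_in e x : hproj e x \in gr e.
Proof. exact: memv_sum_pi. Qed.

Lemma hproj_sum x : \sum_e hproj e x = x.
Proof. by apply: sumv_pi_sum; rewrite (pd_full pd) memvf. Qed.

Lemma hproj_hom x f (e : 'I_d) : x \in gr f ->
  hproj e x = if e == f :> nat then x else 0.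
Proof.
case: (ltnP f d) => [fd xf|df]; last first.
  by rewrite (pd_above pd df) memv0 => /eqP->; rewrite linear0 if_same.
have /directv_sum_unique uniq_sum := pd_direct pd.
have vs_in (i : 'I_d) : true -> (if i == f :> nat then x else 0) \in gr i.
  by move=> _; case: eqP => [->|] // _; apply: mem0v.
have := uniq_sum _ _ (fun i _ => hproj_in i x) vs_in.
rewrite hproj_sum (bigD1 (Ordinal fd)) //= eqxx big1 ?addr0 ?eqxx => [|i].
  by move=> /esym/forall_inP/(_ e isT)/eqP.
by rewrite -val_eqE /= => /negPf->.
Qed.

(** The grading involution, which supplies the sign for moving an odd element past a tensor
    factor. *)
Definition parity (x : H) : H := \sum_(e < d) (-1) ^+ e *: hproj e x.

Fact parity_linear : linear parity.
Proof.
move=> c u v; rewrite /parity scaler_sumr -big_split; apply: eq_bigr => i _.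
by rewrite linearP /= scalerDr !scalerA mulrC.
Qed.
HB.instance Definition _ := GRing.isLinear.Build rat H H *:%R parity parity_linear.

Lemma homogeneous_ind (P : H -> Prop) :
  (forall x y, P x -> P y -> P (x + y)) -> (forall e x, x \in gr e -> P x) ->
  forall x, P x.
Proof.
move=> PD Ph x; rewrite -(hproj_sum x).
elim/big_ind: _ => [|y z|e _]; [|exact: PD|exact: Ph (hproj_in e x)].
by apply: (Ph 0%N); apply: mem0v.
Qed.

Lemma parity_hom e x : x \in gr e -> parity x = (-1) ^+ e *: x.
Proof.
case: (ltnP e d) => [ed xe|de]; last first.
  by rewrite (pd_above pd de) memv0 => /eqP->; rewrite linear0 scaler0.
rewrite /parity (bigD1 (Ordinal ed)) //= (hproj_hom _ xe) eqxx big1 ?addr0 // => i ie.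
by rewrite (hproj_hom _ xe); move: ie; rewrite -val_eqE => /negPf->; rewrite scaler0.
Qed.

Lemma parityK x : parity (parity x) = x.
Proof.
elim/homogeneous_ind: x => [x y hx hy|e x xe]; first by rewrite !linearD /= hx hy.
rewrite (parity_hom xe) linearZZ /= (parity_hom xe) scalerA -exprD.
by rewrite -signr_odd addnn odd_double scale1r.
Qed.

Lemma parityM e x y : x \in gr e -> parity (x * y) = (-1) ^+ e *: (x * parity y).
Proof.
move=> xe; elim/homogeneous_ind: y => [y z hy hz|f y yf].
  by rewrite mulrDr !linearD /= hy hz mulrDr scalerDr.
by rewrite (parity_hom (pd_mul pd xe yf)) (parity_hom yf) -scalerAr scalerA exprD.
Qed.

Lemma hone_gr : 1 \in gr 0.
Proof. by rewrite (pd_connected pd) memv_line. Qed.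

Lemma parity1 : parity 1 = 1.
Proof. by rewrite (parity_hom hone_gr) scale1r. Qed.

(** Multiplying by a basis of the complementary degree and reading coordinates along [w] embeds
    [gr e] in a row space; injectivity is the non-degeneracy of the pairing. *)
Lemma dim_gr_le e : (e <= 2 * m)%N -> (\dim (gr e) <= \dim (gr (2 * m - e)))%N.
Proof.
move=> em; pose Y := vbasis (gr (2 * m - e)).
pose h x : 'rV[rat]_(\dim (gr (2 * m - e))) :=
  \row_j coord [tuple w] ord0 (x * tnth Y j).
have h_linear : linear h.
  by move=> c u v; apply/rowP => j; rewrite !mxE mulrDl -scalerAl linearP.
pose hL : {linear H -> _} := HB.pack h (GRing.isLinear.Build _ _ _ _ h h_linear).
have inj_h : (gr e :&: lker (linfun hL) = 0)%VS.
  apply/eqP; rewrite -subv0; apply/subvP => x; rewrite memv_cap memv_ker lfunE /=.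
  case/andP=> xe /eqP hx; rewrite memv0; apply/eqP.
  apply: (pd_duality pd em xe) => y /coord_vbasis ->; rewrite mulr_sumr big1 // => j _.
  rewrite -scalerAr; apply/eqP; rewrite scaler_eq0; apply/orP; right.
  have xy : x * (vbasis (gr (2 * m - e)))`_j \in <<[tuple w]>>%VS.
    rewrite span_seq1 -(pd_fundamental pd) -[in X in _ \in gr X](subnKC em).
    by apply: (pd_mul pd xe); apply: vbasis_mem; rewrite mem_nth ?size_tuple.
  rewrite (coord_span xy) big_ord1; have /rowP/(_ j) := hx.
  by rewrite !mxE (tnth_nth 0) => ->; rewrite scale0r.
rewrite -(limg_dim_eq inj_h); apply: leq_trans (dimvS (subvf _)) _.
by rewrite dimvf /dim /= mul1n.
Qed.

Lemma dim_gr_dual e : (e <= 2 * m)%N -> \dim (gr e) = \dim (gr (2 * m - e)).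
Proof.
move=> em; apply/eqP; rewrite eqn_leq dim_gr_le //=.
by have := dim_gr_le (leq_subr e (2 * m)); rewrite subKn.
Qed.

(* A linear involution exchanging [H^e] and [H^(2m-e)]; neither multiplicative
   nor canonical. *)
Definition flip (x : H) : H :=
  \sum_(e < d) basis_transfer (vbasis (gr e)) (vbasis (gr (2 * m - e))) (hproj e x).

Fact flip_linear : linear flip.
Proof.
move=> c u v; rewrite /flip scaler_sumr -big_split; apply: eq_bigr => i _.
by rewrite !linearP.
Qed.
HB.instance Definition _ := GRing.isLinear.Build rat H H *:%R flip flip_linear.

Lemma flip_hom e x : (e <= 2 * m)%N -> x \in gr e ->
  flip x = basis_transfer (vbasis (gr e)) (vbasis (gr (2 * m - e))) x.
Proof.
move=> em xe; rewrite /flip (bigD1 (Ordinal (em : (e < d)%N))) //= (hproj_hom _ xe).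
rewrite eqxx big1 ?addr0 // => i ie.
by rewrite (hproj_hom _ xe); move: ie; rewrite -val_eqE => /negPf->; rewrite linear0.
Qed.

Lemma flip_gr e x : (e <= 2 * m)%N -> x \in gr e -> flip x \in gr (2 * m - e).
Proof.
move=> em xe; rewrite (flip_hom em xe); apply: memv_suml => i _; apply: memvZ.
(* An index past the end of the target basis reads the default value 0, which lies in every
   subspace. *)
have [i_lt|i_ge] := ltnP i (size (vbasis (gr (2 * m - e)))).
  by apply: vbasis_mem; rewrite mem_nth.
by rewrite nth_default // mem0v.
Qed.

Lemma flipK x : flip (flip x) = x.
Proof.
elim/homogeneous_ind: x => [x y hx hy|e x xe]; first by rewrite !linearD /= hx hy.
case: (leqP e (2 * m)) => [em|me]; last first.
  by move: xe; rewrite (pd_above pd me) memv0 => /eqP->; rewrite !linear0.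
rewrite (flip_hom (leq_subr e _) (flip_gr em xe)) (flip_hom em xe) subKn //.
apply: basis_transferK; first exact: dim_gr_dual.
  exact: basis_free (vbasisP _).
by rewrite (span_basis (vbasisP _)).
Qed.

End GradedAlgebra.

(** * Tensor powers in coordinates *)

Section LeftMultiplication.
Variables (R : comNzRingType) (A : algType R).
Definition lmul (a b : A) : A := a * b.
Fact lmul_linear a : linear (lmul a).
Proof. by move=> c u v; rewrite /lmul mulrDr scalerAr. Qed.
HB.instance Definition _ a := GRing.isLinear.Build R A A *:%R (lmul a) (lmul_linear a).
End LeftMultiplication.

Section PureTensors.
Variables (H : falgType rat) (n : nat) (E : algType rat).
Local Notation I := 'I_n.
Local Notation N := (\dim {:H}).
Local Notation B := (vbasis {:H}).

(* [tensors] is [H^{\otimes n} \otimes E], written in coordinates, and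
   [pt y a] is [y_1 \otimes ... \otimes y_n \otimes a]. *)
Local Notation word := {ffun I -> 'I_N}.
Definition tensors := word -> E.
HB.instance Definition _ := GRing.Lmodule.on tensors.

Implicit Types (y : I -> H) (a : E).

Definition pt y a : tensors := fun b => (\prod_s coord B (b s) (y s)) *: a.

Lemma coord_full (x : H) : x = \sum_i coord B i x *: B`_i.
Proof. by apply: coord_vbasis; apply: memvf. Qed.

Lemma pt_linear y c a a' : pt y (c *: a + a') = c *: pt y a + pt y a'.
Proof.
by apply/funext => b; rewrite /pt !fctE /= scalerDr !scalerA mulrC.
Qed.

Lemma pt_slot i c y y1 y2 a :
    y i = c *: y1 i + y2 i ->
    (forall s, s != i -> y s = y1 s /\ y s = y2 s) ->
  pt y a = c *: pt y1 a + pt y2 a.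
Proof.
move=> yi ys; apply/funext => b; rewrite /pt !fctE /=.
rewrite (bigD1 i) //= [X in _ = c *: (X *: _) + _](bigD1 i) //=.
rewrite [X in _ = _ + X *: _](bigD1 i) //= yi linearP /=.
rewrite scalerA -scalerDl; congr (_ *: _).
rewrite mulrDl -mulrA; congr (_ * (_ * _) + _ * _).
  by apply: eq_bigr => s /ys[->].
by apply: eq_bigr => s /ys[_ ->].
Qed.

Lemma pt_slot0 i y a : y i = 0 -> pt y a = 0.
Proof.
move=> yi; apply/funext => b; rewrite /pt (bigD1 i) //= yi linear0 mul0r.
exact: scale0r.
Qed.

Lemma pt_scale i c y y1 a :
    y i = c *: y1 i -> (forall s, s != i -> y s = y1 s) ->
  pt y a = c *: pt y1 a.
Proof.
move=> yi ys; pose y2 s := if s == i then 0 else y s.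
rewrite (@pt_slot i c y y1 y2) ?(@pt_slot0 i y2) ?addr0 //.
- by rewrite /y2 eqxx.
- by rewrite /y2 eqxx addr0.
by move=> s si; rewrite /y2 (negPf si) ys.
Qed.

Lemma tensors_sum (v : tensors) : v = \sum_(b : word) pt (fun s => B`_(b s)) (v b).
Proof.
apply/funext => b; rewrite fct_sumE (bigD1 b) //= big1 ?addr0 => [|b' b'b].
  rewrite /pt big1 ?scale1r // => s _; rewrite coord_free ?eqxx //.
  exact: basis_free (vbasisP _).
have [s bs] : exists s, b' s != b s.
  by apply/existsP; rewrite -negb_forall; apply: contra_neqN b'b => /forallP h;
     apply/ffunP => s; apply/eqP.
rewrite /pt (bigD1 s) //= coord_free; last exact: basis_free (vbasisP _).
by rewrite (negPf bs) mul0r scale0r.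
Qed.

Lemma tensors_ext (W : lmodType rat) (f g : {linear tensors -> W}) :
  (forall y a, f (pt y a) = g (pt y a)) -> f =1 g.
Proof.
by move=> fg v; rewrite (tensors_sum v) !linear_sum; apply: eq_bigr => b _.
Qed.

Section TensorMap.
Variables (g : I -> {linear H -> H}) (h : {linear E -> E}).

Definition tensor_map (v : tensors) : tensors :=
  \sum_(b : word) pt (fun s => g s B`_(b s)) (h (v b)).

Fact tensor_map_linear : linear tensor_map.
Proof.
move=> c u v; rewrite /tensor_map scaler_sumr -big_split; apply: eq_bigr => b _.
by rewrite linearP pt_linear.
Qed.

Lemma tensor_map_pt y a : tensor_map (pt y a) = pt (fun s => g s (y s)) (h a).
Proof.
apply/funext => b; rewrite /tensor_map fct_sumE /pt.
transitivity (\sum_(b' : word)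
    (\prod_s coord B (b s) (coord B (b' s) (y s) *: g s B`_(b' s))) *: h a).
  apply: eq_bigr => b' _; rewrite linearZZ scalerA -big_split /=.
  by congr (_ *: _); apply: eq_bigr => s _; rewrite linearZ /= mulrC.
rewrite -scaler_suml; congr (_ *: _).
(* Distributivity turns the sum over words into a product over slots, and each slot contains the
   basis expansion of [y s]. *)
rewrite -(bigA_distr_bigA (fun s j => coord B (b s) (coord B j (y s) *: g s B`_j))).
apply: eq_bigr => s _; rewrite {2}(coord_full (y s)) !linear_sum.
by apply: eq_bigr => j _; rewrite !linearZ.
Qed.
End TensorMap.

Section Evaluation.
Variable p : I -> {linear H -> E}.

Definition tensor_eval (v : tensors) : E :=
  \sum_(b : word) (\prod_s p s B`_(b s)) * v b.

Fact tensor_eval_linear : linear tensor_eval.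
Proof.
move=> c u v; rewrite /tensor_eval scaler_sumr -big_split; apply: eq_bigr => b _.
by rewrite !fctE /= mulrDr scalerAr.
Qed.

Lemma tensor_eval_pt y a : tensor_eval (pt y a) = \prod_s p s (y s) * a.
Proof.
rewrite /tensor_eval /pt.
transitivity ((\sum_(b : word) \prod_s (coord B (b s) (y s) *: p s B`_(b s))) * a).
  rewrite mulr_suml; apply: eq_bigr => b _.
  by rewrite scaler_prod -scalerAr scalerAl.
rewrite -(bigA_distr_bigA (fun s j => coord B j (y s) *: p s B`_j)).
congr (_ * _); apply: eq_bigr => s _; rewrite {2}(coord_full (y s)) linear_sum.
by apply: eq_bigr => j _; rewrite linearZZ.
Qed.
End Evaluation.

Lemma tensors_neq0 : exists v : tensors, v != 0.
Proof.
have N_gt0 : (0 < N)%N.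
  rewrite lt0n dimv_eq0; apply: contraTneq (memvf (1 : H)) => ->.
  by rewrite memv0 oner_eq0.
exists (fun=> 1); apply/eqP => /(congr1 (@^~ [ffun=> Ordinal N_gt0])) /eqP.
by rewrite oner_eq0.
Qed.

End PureTensors.
HB.instance Definition _ H n E g h :=
  GRing.isLinear.Build rat (tensors H n E) (tensors H n E) *:%R (tensor_map g h)
    (@tensor_map_linear H n E g h).
HB.instance Definition _ H n E p :=
  GRing.isLinear.Build rat (tensors H n E) E *:%R (tensor_eval p)
    (@tensor_eval_linear H n E p).

(** * The Kriz relations on tensor powers *)

Section JordanWigner.
Variables (m : nat) (H : falgType rat) (gr : nat -> {vspace H}) (w : H).
Hypothesis pd : poincare_duality_algebra m gr w.
Variables (n : nat) (E : algType rat).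
Local Notation I := 'I_n.
Local Notation d := (2 * m).+1.
Local Notation V := (tensors H n E).
Local Notation End := (linear_endo (tensors_neq0 H n E)).

Definition parity_pow (e : nat) (x : H) : H := if odd e then parity m gr x else x.

Fact parity_pow_linear e : linear (parity_pow e).
Proof. by move=> c u v; rewrite /parity_pow; case: ifP; rewrite // linearP. Qed.
HB.instance Definition _ e :=
  GRing.isLinear.Build rat H H *:%R (parity_pow e) (parity_pow_linear e).

Lemma parity_powD e f x : parity_pow (e + f) x = parity_pow e (parity_pow f x).
Proof.
rewrite /parity_pow oddD; case: (odd e); case: (odd f) => //=.
by rewrite (parityK pd).
Qed.

Lemma parity_pow1 e : parity_pow e 1 = 1.
Proof. by rewrite /parity_pow (parity1 pd) if_same. Qed.

Lemma parity_powM e f (x y : H) : x \in gr f ->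
  parity_pow e (x * y) = (-1) ^+ (e * f) *: (x * parity_pow e y).
Proof.
move=> xf; rewrite /parity_pow -signr_odd oddM; case: (odd e) => /=.
  by rewrite (parityM pd y xf) signr_odd.
by rewrite scale1r.
Qed.

(* Left multiplication by [x] in position [i], with the Koszul sign of moving
   [x], of degree [e], across the positions before [i]. *)
Definition koszul_factor (e : nat) (i : I) (x : H) (s : I) (z : H) : H :=
  if (s < i)%N then parity_pow e z else if s == i then x * z else z.

Fact koszul_factor_linear e i x s : linear (koszul_factor e i x s).
Proof.
move=> c u v; rewrite /koszul_factor; case: ifP => _; first exact: linearP.
by case: ifP => // _; rewrite mulrDr -scalerAr.
Qed.
HB.instance Definition _ e i x s :=
  GRing.isLinear.Build rat H H *:%R (koszul_factor e i x s)
    (koszul_factor_linear e i x s).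

Definition tensor_endo (g : I -> {linear H -> H}) (h : {linear E -> E}) : End :=
  linear_endo_of _ (@tensor_map_linear H n E g h).

Lemma tensor_endo_pt g h (y : I -> H) (a : E) :
  tensor_endo g h (pt y a) = pt (fun s => g s (y s)) (h a).
Proof. exact: tensor_map_pt. Qed.

(** The Koszul sign depends on the degree, so [x] acts through its homogeneous components. *)
Definition pull_op (i : I) (x : H) : End :=
  \sum_(e < d) tensor_endo (fun s => koszul_factor e i (hproj gr e x) s) idfun.

Lemma pull_op_pt i x (y : I -> H) (a : E) : pull_op i x (pt y a) =
  \sum_(e < d) pt (fun s => koszul_factor e i (hproj gr e x) s (y s)) a.
Proof.
rewrite /pull_op; have sumE (F : 'I_d -> End) v : (\sum_e F e) v = \sum_e F e v.
  by elim/big_rec2: _ => // e u f _ <-.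
by rewrite sumE; apply: eq_bigr => e _; apply: tensor_endo_pt.
Qed.

Lemma endo_ext (f g : End) : (forall y a, f (pt y a) = g (pt y a)) -> f = g.
Proof. by move=> fg; apply: linear_endoP; apply: tensors_ext. Qed.

Lemma koszul_slot0 e i (y : I -> H) (a : E) : pt (fun s => koszul_factor e i 0 s (y s)) a = 0.
Proof.
by apply: (pt_slot0 (i := i)); rewrite /koszul_factor ltnn eqxx mul0r.
Qed.

Lemma pull_op_hom i e x (y : I -> H) (a : E) : x \in gr e ->
  pull_op i x (pt y a) = pt (fun s => koszul_factor e i x s (y s)) a.
Proof.
move=> xe; rewrite pull_op_pt; case: (ltnP e d) => [ed|de].
  rewrite (bigD1 (Ordinal ed)) //= big1 => [|f fe].
    by rewrite (hproj_hom pd _ xe) eqxx addr0.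
  rewrite (hproj_hom pd _ xe); move: fe; rewrite -val_eqE => /negPf->.
  exact: koszul_slot0.
move: xe; rewrite (pd_above pd de) memv0 => /eqP->.
by rewrite koszul_slot0 big1 // => f _; rewrite linear0 koszul_slot0.
Qed.

Lemma pull_op_linear i : linear (pull_op i).
Proof.
move=> c x x'; apply: endo_ext => y a.
rewrite linear_endoD linear_endoZ !pull_op_pt scaler_sumr -big_split /=.
apply: eq_bigr => e _; apply: (pt_slot (i := i)).
  by rewrite /koszul_factor ltnn eqxx linearP mulrDl -scalerAl.
by move=> s si; rewrite /koszul_factor (negPf si).
Qed.

Lemma pull_op1 i : pull_op i 1 = 1.
Proof.
apply: endo_ext => y a; rewrite (pull_op_hom _ _ _ (hone_gr pd)) linear_endo1E.
congr (pt _ a); apply/funext => s; rewrite /koszul_factor mul1r.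
by do !case: ifP.
Qed.

Lemma pull_opD i (x y : H) : pull_op i (x + y) = pull_op i x + pull_op i y.
Proof. by have := pull_op_linear i 1 x y; rewrite !scale1r. Qed.

Lemma pull_opZ i c x : pull_op i (c *: x) = c *: pull_op i x.
Proof.
have op0 : pull_op i 0 = 0.
  by apply: (addrI (pull_op i 0)); rewrite -pull_opD !addr0.
by have := pull_op_linear i c x 0; rewrite op0 !addr0.
Qed.

Lemma pull_opM i (x y : H) : pull_op i (x * y) = pull_op i x * pull_op i y.
Proof.
elim/(homogeneous_ind pd): x => [x x' hx hx'|e x xe].
  by rewrite mulrDl !pull_opD mulrDl hx hx'.
elim/(homogeneous_ind pd): y => [y y' hy hy'|f y yf].
  by rewrite mulrDr !pull_opD mulrDr hy hy'.
apply: endo_ext => z a; rewrite linear_endoM (pull_op_hom _ _ _ yf).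
rewrite (pull_op_hom _ _ _ xe) (pull_op_hom _ _ _ (pd_mul pd xe yf)).
congr (pt _ a); apply/funext => s; rewrite /koszul_factor.
by case: ifP => _; [apply: parity_powD | case: ifP => _; rewrite ?mulrA].
Qed.

(** For [i < j] the only slot producing a sign is [i], where the parity due to [y] crosses [x]. For
    [i = j] the sign is that of graded commutativity in [H]. *)
Lemma pull_op_comm i j e f (x y : H) : x \in gr e -> y \in gr f ->
  pull_op i x * pull_op j y = (-1) ^+ (e * f) *: (pull_op j y * pull_op i x).
Proof.
have lt_comm (i' j' : I) e' f' x' y' : (i' < j')%N -> x' \in gr e' -> y' \in gr f' ->
    pull_op j' y' * pull_op i' x'
      = (-1) ^+ (e' * f') *: (pull_op i' x' * pull_op j' y').
  move=> ij xe yf; apply: endo_ext => z a.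
  rewrite linear_endoZ !linear_endoM !(pull_op_hom _ _ _ xe, pull_op_hom _ _ _ yf).
  apply: (pt_scale (i := i')).
    by rewrite /koszul_factor ltnn eqxx ij (parity_powM _ _ xe) mulnC.
  move=> s si; rewrite /koszul_factor (negPf si).
  case: (ltnP s i') => [lt_si|_] //.
  by rewrite (ltn_trans lt_si ij) -!parity_powD addnC.
move=> xe yf; have [ij|ji|/val_inj <-] := ltngtP i j.
- rewrite (lt_comm _ _ _ _ _ _ ij xe yf) scalerA -exprD.
  by rewrite -signr_odd addnn odd_double scale1r.
- by rewrite mulnC; apply: lt_comm.
by rewrite -!pull_opM (pd_comm pd xe yf) pull_opZ.
Qed.

(** * The action attached to the partition into fibres of [r] *)

Section Family.
Variables (p : I -> H -> E) (G : I -> I -> E).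
Hypothesis kf : kriz_family gr p G.
Variable r : I -> I.

(** The factor [E] stands last, so the odd generator crosses every slot and leaves [parity] in
    each. *)
Definition edge_op (i j : I) : End :=
  if r i == r j then tensor_endo (fun=> parity m gr) (lmul (G i j)) else 0.

Lemma edge_op_pt i j (y : I -> H) (a : E) : r i = r j ->
  edge_op i j (pt y a) = pt (fun s => parity m gr (y s)) (G i j * a).
Proof. by move=> rij; rewrite /edge_op rij eqxx; apply: tensor_endo_pt. Qed.

Lemma edge_op0 i j : r i <> r j -> edge_op i j = 0.
Proof. by move=> /eqP rij; rewrite /edge_op (negPf rij). Qed.

Lemma pt0 (y : I -> H) : pt y (0 : E) = 0.
Proof. by apply/funext => b; rewrite /pt scaler0. Qed.
Lemma ptD (y : I -> H) (a a' : E) : pt y (a + a') = pt y a + pt y a'.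
Proof. by rewrite -[a]scale1r pt_linear !scale1r. Qed.
Lemma ptN (y : I -> H) (a : E) : pt y (- a) = - pt y a.
Proof. by rewrite -[- a]addr0 -scaleN1r pt_linear pt0 addr0 scaleN1r. Qed.

Lemma edge_op_edge_op i j h l (y : I -> H) (a : E) : r i = r j -> r h = r l ->
  edge_op i j (edge_op h l (pt y a)) = pt y (G i j * G h l * a).
Proof.
move=> rij rhl; rewrite !edge_op_pt // mulrA; congr (pt _ _).
by apply/funext => s; rewrite (parityK pd).
Qed.

Lemma kriz_family_op : kriz_family gr (fun i => pull_op (r i)) edge_op.
Proof.
split=> [i|i|i x y|i j e f x y|h i j e x xe|i j h l|i j|i|i j x|i j k ij jk ik].
- exact: pull_op_linear.
- exact: pull_op1.
- exact: pull_opM.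
- exact: pull_op_comm.
- case: (r i =P r j) => [rij|/edge_op0->]; last by rewrite mulr0 mul0r scaler0.
  apply: endo_ext => y a; rewrite linear_endoZ !linear_endoM.
  rewrite (pull_op_hom _ _ _ xe) !edge_op_pt // (pull_op_hom _ _ _ xe).
  apply: (pt_scale (i := r h)).
    by rewrite /koszul_factor ltnn eqxx (parityM pd _ xe) scalerA -exprD
               -signr_odd addnn odd_double scale1r.
  move=> s si; rewrite /koszul_factor (negPf si); case: ifP => // _.
  by rewrite /parity_pow; case: ifP.
- case: (r i =P r j) => [rij|/edge_op0->]; last by rewrite mulr0 mul0r oppr0.
  case: (r h =P r l) => [rhl|/edge_op0->]; last by rewrite mulr0 mul0r oppr0.
  apply: endo_ext => y a; rewrite -scaleN1r linear_endoZ scaleN1r !linear_endoM.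
  by rewrite !edge_op_edge_op // (kf_G_comm kf i) mulNr ptN.
- by rewrite /edge_op eq_sym (kf_G_sym kf).
- apply: endo_ext => y a.
  by rewrite edge_op_pt // (kf_G_diag kf) mul0r pt0.
- by case: (r i =P r j) => [->//|/edge_op0->]; rewrite !mulr0.
(* If the three vertices do not lie in one block, at most one of the three edges acts non-trivially,
   so every product of two of them vanishes. *)
- case: (r i =P r j) => [rij|rij]; last first.
    rewrite (edge_op0 rij) mul0r mulr0 add0r addr0.
    case: (r j =P r k) => [rjk|/edge_op0->]; last by rewrite mul0r.
    by rewrite (@edge_op0 k i) ?mulr0 // -rjk => /esym.
  case: (r j =P r k) => [rjk|rjk]; last first.
    rewrite (edge_op0 rjk) mul0r mulr0 !add0r.
    by rewrite (@edge_op0 k i) ?mul0r // rij => /esym.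
  have rki : r k = r i by rewrite rij.
  apply: endo_ext => y a; rewrite !linear_endoD !linear_endoM.
  by rewrite !edge_op_edge_op // -!ptD -!mulrDl (kf_arnold kf) // mul0r pt0.
Qed.

Lemma pull_op_first (i : I) (x : H) (y : I -> H) (a : E) : (forall s : I, (s <= i)%N -> y s = 1) ->
  pull_op i x (pt y a) = pt (fun s => if s == i then x else y s) a.
Proof.
move=> y1; elim/(homogeneous_ind pd): x => [x x' hx hx'|e x xe].
  rewrite pull_opD linear_endoD hx hx' -[pt _ a in LHS]scale1r; apply/esym.
  apply: (pt_slot (i := i)); first by rewrite eqxx scale1r.
  by move=> s /negPf->.
rewrite (pull_op_hom _ _ _ xe); congr (pt _ a); apply/funext => s.
rewrite /koszul_factor; case: ltngtP => [si|is_|/val_inj ->].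
- by rewrite -val_eqE ltn_eqF // y1 ?(ltnW si) // parity_pow1.
- by rewrite -val_eqE gtn_eqF.
by rewrite eqxx y1 // mulr1.
Qed.

(** The factors act from the last slot down to the first, so each crosses only slots still holding
    [1], which [parity] fixes, and no sign appears. *)
Lemma prod_pull_op (y : I -> H) (a : E) : (\prod_s pull_op s (y s)) (pt (fun=> 1) a) = pt y a.
Proof.
suff prodE (l : seq I) : sorted (fun s t : I => s < t)%N l ->
    (\prod_(s <- l) pull_op s (y s)) (pt (fun=> 1) a)
      = pt (fun s => if s \in l then y s else 1) a.
  have -> : index_enum I = enum I by rewrite enumT [index_enum _]unlock.
  rewrite prodE /=.
    by congr (pt _ a); apply/funext => s; rewrite mem_enum.
  by have := iota_ltn_sorted 0 n; rewrite -val_enum_ord sorted_map.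
elim: l => [_|i l IH il]; first by rewrite big_nil linear_endo1E.
have lt_trans : transitive (fun s t : I => s < t)%N by move=> ? ? ?; apply: ltn_trans.
rewrite big_cons linear_endoM IH ?(path_sorted il) // pull_op_first.
  congr (pt _ a); apply/funext => s; rewrite inE.
  by case: eqP => // ->.
move=> s si; case: ifP => // /(allP (order_path_min lt_trans il)).
by rewrite ltnNge si.
Qed.

Lemma Gprod_edge_op F : (forall e, e \in F -> r e.1 = r e.2) ->
  Gprod edge_op F (pt (fun=> 1) 1) = pt (fun=> 1) (Gprod G F).
Proof.
elim: F => [_|e F IH eF]; first by rewrite /Gprod !big_nil linear_endo1E.
have {}IH := IH (fun f fF => eF f (mem_behead (s := e :: F) fF)).
rewrite !Gprod_cons linear_endoM IH edge_op_pt ?eF ?mem_head //.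
by congr (pt _ _); apply/funext => s; rewrite (parity1 pd).
Qed.

Lemma Gprod_edge_op0 F e : e \in F -> r e.1 <> r e.2 -> Gprod edge_op F = 0.
Proof.
elim: F => //= f F IH; rewrite inE Gprod_cons => /predU1P[<- /edge_op0->|eF re].
  exact: mul0r.
by rewrite IH // mulr0.
Qed.

End Family.
End JordanWigner.

(** * The duality map *)

Lemma filter_index_enum (T : finType) (P : pred T) :
  filter P (index_enum T) = enum P.
Proof. by rewrite [index_enum T]unlock. Qed.

Section FlipMap.
Variables (m : nat) (H : falgType rat) (gr : nat -> {vspace H}) (w : H).
Hypothesis pd : poincare_duality_algebra m gr w.
Variables (n : nat) (E : algType rat).
Local Notation I := 'I_n.
Variables (p : I -> H -> E) (G : I -> I -> E).
Hypothesis kf : kriz_family gr p G.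

Definition flip_at F (y : I -> H) (s : I) : H :=
  if rep F s == s then flip m gr (y s) else y s.

Definition flip_deg F (d : I -> nat) (s : I) : nat :=
  if rep F s == s then (2 * m - d s)%N else d s.

Lemma supported_flip F y d : supported gr F y d -> (forall s, d s <= 2 * m)%N ->
  supported gr F (flip_at F y) (flip_deg F d).
Proof.
move=> [yd y1] dm; split=> s; rewrite /flip_at /flip_deg; last first.
  by move=> rs; rewrite (negPf rs); apply: y1.
by case: ifP => _; [apply: (flip_gr pd (dm s) (yd s)) | apply: yd].
Qed.

Lemma flip_atK F y : flip_at F (flip_at F y) = y.
Proof.
apply/funext => s; rewrite /flip_at; case: (rep F s == s) => //; exact: (flipK pd).
Qed.

(** The existence half of the universal property of the presented algebra; it is what makes [E] act
    on tensor powers. *)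
Definition kriz_universal := forall (B : algType rat) p' G',
  kriz_family gr p' G' ->
  exists D : {lrmorphism E -> B}, (forall i x, D (p i x) = p' i x) /\
                                  (forall i j, D (G i j) = G' i j).

(* The sum runs over the partitions into [n - q] blocks.  A forest with [q]
   edges lying inside the blocks of such a partition spans it, so exactly one
   summand is non-zero on a given normal form. *)
Lemma flip_map_exists q : kriz_universal ->
  exists f : {linear E -> E}, forall F y, forest F -> size F = q ->
    (forall s, rep F s != s -> y s = 1) -> f (nf p G F y) = nf p G F (flip_at F y).
Proof.
move=> univ.
have [D hD] := choice (fun r : {ffun I -> I} => univ _ _ _ (kriz_family_op pd kf r)).
pose pL i : {linear H -> E} :=
  HB.pack (p i) (GRing.isLinear.Build _ _ _ _ (p i) (kf_linear kf i)).
pose g (r : {ffun I -> I}) s : {linear H -> H} :=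
  if r s == s then (flip m gr : {linear H -> H}) else (idfun : {linear H -> H}).
(* Each summand applies the action for [r] to the unit tensor, flips the slot of every block, and
   multiplies the result back into [E]. *)
pose f u := \sum_(r : {ffun I -> I} | representatives r &&
                                     (#|[set s | r s == s]| + q == n)%N)
  tensor_eval pL (tensor_map (g r) idfun (D r u (pt (fun=> 1) 1))).
have f_linear : linear f.
  move=> c u v; rewrite /f scaler_sumr -big_split; apply: eq_bigr => r _.
  by rewrite linearP linear_endoD linear_endoZ !linearP.
pose fL : {linear E -> E} :=
  HB.pack f (GRing.isLinear.Build _ _ _ _ f f_linear).
exists fL => F y fF sF y1; rewrite /= /f.
have Dnf r : D r (nf p G F y)
    = \prod_s pull_op m gr E (r s) (y s) * Gprod (edge_op m gr G r) F.
  have [Dp DG] := hD r; rewrite rmorphM !rmorph_prod; congr (_ * _).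
    by apply: eq_bigr => s _; apply: Dp.
  by apply: eq_bigr => e _; apply: DG.
pose r0 := finfun (rep F).
have card0 : #|[set s | r0 s == s]| = #|[set s | rep F s == s]|.
  by apply: eq_card => s; rewrite !inE ffunE.
rewrite (bigD1 r0) /=; last by rewrite rep_representatives card0 -sF card_rep ?eqxx.
rewrite big1 ?addr0 => [|r /andP[/andP[repr card_r] rr0]]; last first.
  (* If [r] kept all edges of [F] inside its blocks, [rep_unique] would identify it with [r0], both
     having [n - q] blocks; hence some edge acts as zero. *)
  have [e eF re] : exists2 e, e \in F & r e.1 <> r e.2.
    apply: contrapT => no_e; move/eqP: rr0; apply; apply: rep_unique => //.
      by move=> e eF; apply: contrapT => re; apply: no_e; exists e.
    apply/eqP; rewrite -(eqn_add2r q) (eqP card_r) -sF card_rep //.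
  by rewrite Dnf (Gprod_edge_op0 _ _ _ eF re) mulr0 !linear0.
rewrite Dnf linear_endoM (Gprod_edge_op pd) => [|e eF]; last first.
  by rewrite !ffunE; apply: rep_edge.
(* At a non-representative the label is [1], so its operator is the identity in either slot. *)
rewrite (eq_bigr (fun s => pull_op m gr E s (y s))) => [|s _]; last first.
  by rewrite ffunE; case: (rep F s =P s) => [->|/eqP/y1->] //; rewrite !(pull_op1 pd).
rewrite (prod_pull_op pd) tensor_map_pt tensor_eval_pt /nf /=; congr (_ * _).
by apply: eq_bigr => s _; rewrite /flip_at /g ffunE; case: ifP.
Qed.

(** The sign for bringing a factor next to [Gprod G F] depends on degrees only, so it is the same on
    both sides. *)
Lemma pull_prod_rep F (a : I -> I) y (d : I -> nat) (l : seq I) :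
    (forall s, y s \in gr (d s)) ->
  \prod_(s <- l) p (a s) (y s) * Gprod G F
    = \prod_(s <- l) p (rep F (a s)) (y s) * Gprod G F.
Proof.
move=> yd; elim: l => [|s l IH]; first by rewrite !big_nil.
have comm i : p i (y s) * \prod_(t <- l) p (rep F (a t)) (y t)
    = (-1) ^+ (d s * (\sum_(t <- l) d t)%N)
      *: (\prod_(t <- l) p (rep F (a t)) (y t) * p i (y s)).
  by apply: prod_commute_sign => t _; apply: (kf_pull_comm kf).
rewrite !big_cons -mulrA IH mulrA !comm -!scalerAl -!mulrA.
by rewrite (pull_Gprod_rep kf _ _ (yd s)).
Qed.

(** * Transport of labels between the representatives of two forests *)

Section Transport.
Variables (F F' : seq (I * I)) (t : I -> I).
Hypothesis t_inj : {in [pred s | rep F s == s] &, injective t}.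
Hypothesis t_rep : forall s, rep F' (t s) = t s.
Hypothesis card_eq : #|[set s | rep F s == s]| = #|[set s | rep F' s == s]|.

(** Push-forward along [t] of the values at representatives; [a0] is the neutral value, [1] for
    labels and [0] for degrees. *)
Definition transport (A : Type) (a0 : A) (y : I -> A) (s' : I) : A :=
  oapp y a0 [pick s | (rep F s == s) && (t s == s')].

Lemma transportE (A : Type) (a0 : A) y s : rep F s == s -> transport a0 y (t s) = y s.
Proof.
move=> rs; rewrite /transport; case: pickP => [s0 /andP[rs0 /eqP ts0]|/(_ s)] /=.
  by rewrite (t_inj _ _ ts0) // inE.
by rewrite rs eqxx.
Qed.

Lemma transport_default (A : Type) (a0 : A) y s' :
  rep F' s' != s' -> transport a0 y s' = a0.
Proof.
move=> rs'; rewrite /transport; case: pickP => //= s /andP[_ /eqP ts].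
by rewrite -ts t_rep eqxx in rs'.
Qed.

(** Injectivity and equal cardinality make [t] a bijection on representatives. It need not preserve
    their order, hence a permutation of lists. *)
Lemma perm_transport :
  perm_eq [seq t s | s <- enum [pred s | rep F s == s]]
          (enum [pred s | rep F' s == s]).
Proof.
have u1 : uniq [seq t s | s <- enum [pred s | rep F s == s]].
  rewrite map_inj_in_uniq ?enum_uniq // => s s'.
  by rewrite !mem_enum; apply: t_inj.
have sub : {subset [seq t s | s <- enum [pred s | rep F s == s]]
             <= enum [pred s | rep F' s == s]}.
  by move=> _ /mapP[s _ ->]; rewrite mem_enum inE t_rep.
have [|_ memE] := uniq_min_size u1 sub; last exact: uniq_perm u1 (enum_uniq _) memE.
rewrite size_map -!cardE; move: card_eq; rewrite !cardsE => ->.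
exact: leqnn.
Qed.

Lemma transport_rep s' : rep F' s' == s' -> exists2 s, rep F s == s & t s = s'.
Proof.
move=> rs'; have: s' \in enum [pred s | rep F' s == s] by rewrite mem_enum.
rewrite -(perm_mem perm_transport) => /mapP[s]; rewrite mem_enum => rs ->.
by exists s.
Qed.

Lemma transport_gr y d : supported gr F y d ->
  forall s', transport 1 y s' \in gr (transport 0%N d s').
Proof.
move=> [yd _] s'; rewrite /transport; case: pickP => [s _|_] /=; first exact: yd.
exact: (hone_gr pd).
Qed.

Lemma transport_flip_at y :
  transport 1 (flip_at F y) = flip_at F' (transport 1 y).
Proof.
apply/funext => s'; rewrite {2}/flip_at; case: ifPn => rs'; last first.
  by rewrite !transport_default.
have [s rs <-] := transport_rep rs'; rewrite !transportE //.
by rewrite /flip_at rs.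
Qed.

(* The reordering sign depends on the parities of the degrees only, and these
   are preserved by [flip_at]. *)
Lemma transport_nf d : exists b : nat, forall y d',
    supported gr F y d' -> (forall s, odd (d' s) = odd (d s)) ->
  \prod_s p (t s) (y s) * Gprod G F' = (-1) ^+ b *: nf p G F' (transport 1 y).
Proof.
have [b hb] := perm_prod_sign E (transport 0%N d) perm_transport.
exists b => y d' supp d'd; have [yd' y1] := supp.
have -> : \prod_s p (t s) (y s)
    = \prod_(s' <- [seq t s | s <- enum [pred s | rep F s == s]])
        p s' (transport 1 y s').
  rewrite big_map -filter_index_enum big_filter [RHS]big_mkcond /=.
  apply: eq_bigr => s _; case: ifPn => [rs|/y1[-> _]]; last exact: (kf_pull1 kf).
  by rewrite transportE.
have -> : nf p G F' (transport 1 y)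
    = \prod_(s' <- enum [pred s | rep F' s == s]) p s' (transport 1 y s') * Gprod G F'.
  rewrite -filter_index_enum big_filter [in RHS]big_mkcond /=; congr (_ * _).
  apply: eq_bigr => s _; case: ifPn => // rs; rewrite transport_default //.
  exact: (kf_pull1 kf).
rewrite scalerAl -hb // => i j.
rewrite (kf_pull_comm kf _ _ (transport_gr supp i) (transport_gr supp j)).
rewrite -signr_odd -[in RHS]signr_odd !oddM.
have odd_t s' : odd (transport 0%N d' s') = odd (transport 0%N d s').
  by rewrite /transport; case: pickP => //= s _; apply: d'd.
by rewrite !odd_t.
Qed.

End Transport.

(** The representatives of the relabelled edges need not be the images of the old ones. Sliding the
    labels to them and reordering costs a sign that [y] and its flip share. *)
Lemma flip_map_act q (f : {linear E -> E}) (s : 'S_n) (A : {rmorphism E -> E}) F y d :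
    (forall F y, forest F -> size F = q ->
      (forall s, rep F s != s -> y s = 1) ->
      f (nf p G F y) = nf p G F (flip_at F y)) ->
    (forall i x, A (p i x) = p (s i) x) ->
    (forall i j, A (G i j) = G (s i) (s j)) ->
    forest F -> size F = q -> supported gr F y d -> (forall s, d s <= 2 * m)%N ->
  f (A (nf p G F y)) = A (nf p G F (flip_at F y)).
Proof.
move=> f_nf Ap AG fF sF supp dm; pose F' := [seq (s e.1, s e.2) | e <- F].
have Anf z : A (nf p G F z) = \prod_i p (s i) (z i) * Gprod G F'.
  rewrite rmorphM !rmorph_prod; congr (_ * _); first by apply: eq_bigr => i _.
  by rewrite [RHS]big_map; apply: eq_bigr => e _.
rewrite !Anf; case: (boolP (forest F')) => fF'; last first.
  by rewrite (Gprod_nforest kf fF') !mulr0 linear0.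
pose t i := rep F' (s i).
have t_inj : {in [pred i | rep F i == i] &, injective t}.
  move=> i j; rewrite !inE => /eqP ri /eqP rj tij.
  (* Composed with the inverse of [s], [rep F] is constant along [F'], so [t i] determines the
     component of [i]. *)
  have h_const e : e \in F' -> rep F ((s^-1)%g e.1) = rep F ((s^-1)%g e.2).
    by case/mapP=> e' e'F -> /=; rewrite !permK; apply: rep_edge.
  have h_rep k : rep F ((s^-1)%g (t k)) = rep F k.
    by have := rep_const (h := fun k => rep F ((s^-1)%g k)) h_const (s k); rewrite permK.
  by rewrite -ri -rj -(h_rep i) tij h_rep.
have t_rep i : rep F' (t i) = t i by apply: rep_idem.
have card_eq : #|[set i | rep F i == i]| = #|[set i | rep F' i == i]|.
  apply/eqP; rewrite -(eqn_add2r q) -{1}sF card_rep // -sF.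
  by rewrite -(size_map (fun e => (s e.1, s e.2)) F) card_rep.
have [b hb] := transport_nf t_inj t_rep card_eq d.
have supp' := supported_flip supp dm.
rewrite (pull_prod_rep _ _ _ supp.1) (pull_prod_rep _ _ _ supp'.1).
(* A flipped degree [2 * m - d i] has the parity of [d i], so the same [b] serves both sides. *)
rewrite (hb _ _ supp) // (hb _ _ supp') => [|i]; last first.
  rewrite /flip_deg; case: ifP => // _.
  by rewrite oddB ?dm // oddM.
rewrite linearZZ f_nf //; last by move=> i; apply: transport_default.
  by rewrite (transport_flip_at t_inj t_rep card_eq).
by rewrite size_map.
Qed.

End FlipMap.

(** * The presented algebra *)


Section KrizBidegree.
Variables (m : nat) (H : falgType rat) (gr : nat -> {vspace H}) (n : nat).
Local Notation E := (quotient_algebra (@kriz_rel m H gr n)).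
Local Notation bideg := (@kriz_bideg m H gr n).

Lemma kriz_bideg_monomial q k u : kriz_monomial q k u -> bideg q k u.
Proof.
move=> mu; exists 1%N, (fun=> 1), (fun=> u); split=> //.
by rewrite big_ord1 scale1r.
Qed.

Lemma kriz_bideg0 q k : bideg q k 0.
Proof. by exists 0%N, (fun=> 0), (fun=> 0); split=> [[]//|]; rewrite big_ord0. Qed.

Lemma kriz_bidegZ q k c u : bideg q k u -> bideg q k (c *: u).
Proof.
case=> N [b [v [mv ->]]]; exists N, (fun a => c * b a), v; split=> //.
by rewrite scaler_sumr; apply: eq_bigr => a _; rewrite scalerA.
Qed.

Lemma kriz_bidegD q k u v : bideg q k u -> bideg q k v -> bideg q k (u + v).
Proof.
case=> N [b [x [mx ->]]] [N' [b' [x' [mx' ->]]]].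
exists (N + N')%N, (fun a => match fintype.split a with inl i => b i | inr i => b' i end).
exists (fun a => match fintype.split a with inl i => x i | inr i => x' i end).
split=> [a|]; first by case: (fintype.split a).
by rewrite big_split_ord; congr (_ + _); apply: eq_bigr => a _;
   [have /= -> := unsplitK (inl a : 'I_N + 'I_N') | have /= -> := unsplitK (inr a : 'I_N + 'I_N')].
Qed.

Lemma kriz_bideg_ind q k (P : E -> Prop) :
    P 0 -> (forall u v, P u -> P v -> P (u + v)) ->
    (forall c u, P u -> P (c *: u)) -> (forall u, kriz_monomial q k u -> P u) ->
  forall u, bideg q k u -> P u.
Proof.
move=> P0 PD PZ Pm u [N [c [v [mv ->]]]].
by elim/big_ind: _ => // a _; apply/PZ/Pm.
Qed.

Lemma kriz_monomial_prod (y : 'I_n -> H) d F (l : seq 'I_n) :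
    (forall s, y s \in gr (d s)) -> {in F, forall e, e.1 != e.2} ->
  @kriz_monomial m H gr n (size F) ((2 * m - 1) * size F + \sum_(s <- l) d s)
    (\prod_(s <- l) kriz_pull m gr s (y s) * \prod_(e <- F) kriz_G m gr e.1 e.2).
Proof.
move=> yd Fne; elim: l => [|s l IH].
  rewrite !big_nil mul1r addn0; elim: F Fne => [_|e F IH Fne].
    by rewrite muln0 big_nil; apply: kriz_monomial1.
  rewrite big_cons mulnS; apply: kriz_monomial_G; first by apply/Fne/mem_head.
  by apply: IH => f fF; apply: Fne; rewrite inE fF orbT.
rewrite !big_cons addnCA -mulrA; exact: (kriz_monomial_pull s (yd s) IH).
Qed.

Hypothesis m_gt0 : (0 < m)%N.

Lemma kriz_act0 s : kriz_act s (0 : E) = 0.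
Proof.
have := kriz_act_linear m_gt0 s (-1) 0 (0 : E).
by rewrite scaler0 addr0 scaleN1r addNr.
Qed.

Lemma kriz_actD s (u v : E) : kriz_act s (u + v) = kriz_act s u + kriz_act s v.
Proof. by have := kriz_act_linear m_gt0 s 1 u v; rewrite !scale1r. Qed.

Lemma kriz_actZ s c (u : E) : kriz_act s (c *: u) = c *: kriz_act s u.
Proof.
by have := kriz_act_linear m_gt0 s c u 0; rewrite kriz_act0 !addr0.
Qed.

End KrizBidegree.

(** * The Kriz model as a Kriz family, and its duality *)

Section KrizAlgebra.
Variables (m : nat) (H : falgType rat) (gr : nat -> {vspace H}) (n : nat).
Local Notation E := (quotient_algebra (@kriz_rel m H gr n)).

(** An [algType] is non-trivial, so this alias carries the proof of [1 != 0] from which its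
    instances are built. *)
Definition kriz_algebra (nz : (1 : E) != 0) : Type := E.

Variable nz : (1 : E) != 0.
Local Notation A := (kriz_algebra nz).

HB.instance Definition _ := GRing.PzRing.on A.
HB.instance Definition _ := GRing.Lmodule.on A.
HB.instance Definition _ := GRing.PzSemiRing_isNonZero.Build A nz.
HB.instance Definition _ := GRing.Lmodule_isLalgebra.Build rat A
  (@quotient_scaleAl _ (@kriz_rel m H gr n)).
HB.instance Definition _ := GRing.Lalgebra_isAlgebra.Build rat A
  (@quotient_scaleAr _ (@kriz_rel m H gr n)).

Hypothesis m_gt0 : (0 < m)%N.

Let pull : 'I_n -> H -> A := kriz_pull m gr (n := n).
Let edge : 'I_n -> 'I_n -> A := kriz_G m gr (n := n).

Lemma odd_edge_degree e : (-1) ^+ (e * (2 * m - 1)) = (-1) ^+ e :> rat.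
Proof.
rewrite -signr_odd oddM; have -> : odd (2 * m - 1) = true by lia.
by rewrite andbT signr_odd.
Qed.

Lemma kriz_algebra_family : kriz_family gr pull edge.
Proof.
rewrite /pull /edge.
split=> [i c x y|i|i x y|i j e f x y xe yf|h i j e x xe|i j h l|i j|i|i j x|i j k].
- rewrite !kriz_pullE -class_ofZ -class_ofD.
  exact: (class_of_rel (kriz_pull_linear _ _ _ _ _ _)).
- by rewrite kriz_pullE -class_of1; apply: class_of_rel; apply: kriz_pull1.
- by rewrite !kriz_pullE -class_ofM; apply: class_of_rel; apply: kriz_pullM.
- rewrite !kriz_pullE -!class_ofM -class_ofZ.
  by apply: class_of_rel; apply: kriz_pull_comm.
- rewrite -odd_edge_degree kriz_pullE kriz_GE -!class_ofM -class_ofZ.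
  by apply: class_of_rel; apply: kriz_pull_G_comm.
- exact: kriz_G_commE.
- exact: kriz_G_symE.
- by rewrite kriz_GE /free_G insubF ?class_of0 //= eqxx.
- exact: kriz_pullG_E.
- exact: kriz_arnoldE.
Qed.

Section Lift.
Variables (B : algType rat) (p : 'I_n -> H -> B) (G : 'I_n -> 'I_n -> B).
Hypothesis kf : kriz_family gr p G.

Definition letter_lift (l : kriz_letter H n) : B :=
  match l with inl ix => p ix.1 ix.2 | inr ij => G (val ij).1 (val ij).2 end.

Definition lift : free_algebra (kriz_letter H n) -> B := free_lift letter_lift.
HB.instance Definition _ := GRing.RMorphism.copy lift (free_lift letter_lift).
HB.instance Definition _ := GRing.Linear.copy lift (free_lift letter_lift).

Lemma lift_pull i x : lift (free_pull i x) = p i x.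
Proof. exact: free_lift_letter. Qed.

Lemma lift_G i j : lift (free_G H i j) = G i j.
Proof.
rewrite /free_G; case: insubP => [ij _ vij|].
  by rewrite [LHS]free_lift_letter /= vij.
by rewrite negbK => /eqP /= ->; rewrite linear0 (kf_G_diag kf).
Qed.

Lemma lift_rel a b : kriz_rel m gr a b -> lift a = lift b.
Proof.
case=> [i c x y|i|i x y|i j e f x y xe yf|h i j e x xe|i j h l
  |i j|i j x _|i j k ij jk].
- by rewrite lift_pull linearD linearZZ /= !lift_pull (kf_linear kf).
- by rewrite lift_pull (kf_pull1 kf) rmorph1.
- by rewrite lift_pull rmorphM /= !lift_pull (kf_pullM kf).
- by rewrite rmorphM /= !lift_pull linearZZ rmorphM /= !lift_pull (kf_pull_comm kf _ _ xe yf).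
- rewrite rmorphM /= lift_pull lift_G linearZZ rmorphM /= lift_pull lift_G.
  by rewrite (kf_pull_G_comm kf _ _ _ xe) odd_edge_degree.
- rewrite rmorphM /= !lift_G linearZZ rmorphM /= !lift_G (kf_G_comm kf) odd_edge_degree.
  have := odd_edge_degree 1; rewrite mul1n => ->.
  by rewrite expr1 scaleN1r.
- by rewrite !lift_G (kf_G_sym kf).
- by rewrite rmorphM /= lift_pull lift_G rmorphM /= lift_pull lift_G (kf_pull_G kf).
rewrite rmorphB !rmorphM /= !lift_G.
have neq (a' b' : 'I_n) : (a' < b')%N -> a' != b' by rewrite -val_eqE neq_ltn => ->.
have /eqP := kf_arnold kf (neq _ _ ij) (neq _ _ jk) (neq _ _ (ltn_trans ij jk)).
rewrite (kf_G_sym kf i k) (kf_G_comm kf j k) (kf_G_comm kf i k i j) addrAC.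
by rewrite subr_eq0 => /eqP.
Qed.

Lemma lift_ideal a : rel_ideal (kriz_rel m gr (n := n)) a -> lift a = 0.
Proof.
elim=> [b c r||b c _ hb _ hc|b c _ h|b c _ h].
- by rewrite linearB /= (lift_rel r) subrr.
- exact: linear0.
- by rewrite linearD /= hb hc addr0.
- by rewrite rmorphM /= h mulr0.
- by rewrite rmorphM /= h mul0r.
Qed.

Definition kriz_lift (u : A) : B := lift (repr (u : E)).

Lemma kriz_lift_class a : kriz_lift (class_of _ a) = lift a.
Proof.
apply/eqP; rewrite -subr_eq0 -linearB; apply/eqP/lift_ideal.
exact: repr_class_of.
Qed.

Fact kriz_lift_linear : linear kriz_lift.
Proof.
move=> c; elim/class_ind=> a; elim/class_ind=> b.
rewrite -class_ofZ -class_ofD !kriz_lift_class.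
exact: linearP.
Qed.

Fact kriz_lift_monoid : monoid_morphism kriz_lift.
Proof.
split; first by rewrite -class_of1 kriz_lift_class rmorph1.
elim/class_ind=> a; elim/class_ind=> b.
by rewrite -class_ofM !kriz_lift_class rmorphM.
Qed.

Definition kriz_lift_lrmorphism : {lrmorphism A -> B} :=
  HB.pack kriz_lift (GRing.isLinear.Build rat A B *:%R kriz_lift kriz_lift_linear)
    (GRing.isMonoidMorphism.Build A B kriz_lift kriz_lift_monoid).

End Lift.

Lemma kriz_algebra_universal : kriz_universal gr pull edge.
Proof.
move=> B p G kf; exists (kriz_lift_lrmorphism kf).
split=> *; rewrite /= /pull /edge ?kriz_pullE ?kriz_GE (kriz_lift_class kf).
  exact: lift_pull.
exact: lift_G.
Qed.

Fact kriz_act_zmod s : zmod_morphism (@kriz_act m H gr n s : A -> A).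
Proof.
by move=> u v; rewrite addrC -scaleN1r kriz_act_linear // scaleN1r addrC.
Qed.
Fact kriz_act_monoid s : monoid_morphism (@kriz_act m H gr n s : A -> A).
Proof. by split; [apply: kriz_act1 | apply: kriz_actM]. Qed.

Definition kriz_act_rmorphism s : {rmorphism A -> A} :=
  HB.pack (@kriz_act m H gr n s : A -> A)
    (GRing.isZmodMorphism.Build A A _ (kriz_act_zmod s))
    (GRing.isMonoidMorphism.Build A A _ (kriz_act_monoid s)).

Variable w : H.
Hypothesis pd : poincare_duality_algebra m gr w.
Local Notation bideg := (@kriz_bideg m H gr n).

(** Every monomial is zero or a multiple of a normal form, so statements closed under linear
    combinations need checking on normal forms only. *)
Lemma kriz_bideg_nf_ind q k (P : A -> Prop) :
    P 0 -> (forall u v, P u -> P v -> P (u + v)) ->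
    (forall c u, P u -> P (c *: u)) ->
    (forall F y d, forest F -> size F = q -> supported gr F y d ->
      (forall s, d s <= 2 * m)%N -> ((2 * m - 1) * q + \sum_s d s = k)%N ->
      P (nf pull edge F y)) ->
  forall u, bideg q k u -> P u.
Proof.
move=> P0 PD PZ Pnf; apply: kriz_bideg_ind => // u mu.
have {mu} : monomial gr pull edge m q k u.
  elim: mu => [|q' k' i e x v xe _|q' k' i j v _ _].
  - exact: monomial1.
  - exact: monomial_pull.
  - exact: (monomial_G kriz_algebra_family).
case/(monomial_nf kriz_algebra_family (pd_mul pd) (hone_gr pd)) => [-> //|].
case=> c [F [y [d [fF sF supp dk ->]]]]; apply: PZ.
(* A label of degree above [2 * m] is zero and kills the normal form, so the degrees may be assumed
   bounded. *)
case: (boolP [forall s, (d s <= 2 * m)%N]) => [/forallP dm|].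
  exact: Pnf dk.
rewrite negb_forall => /existsP[s]; rewrite -ltnNge => ds.
suff -> : nf pull edge F y = 0 by [].
have ys : y s = 0 by have := supp.1 s; rewrite (pd_above pd ds) memv0 => /eqP.
have p0 : pull s 0 = 0.
  have := kf_linear kriz_algebra_family s (-1) 0 0.
  by rewrite scaler0 addr0 scaleN1r addNr.
rewrite /nf (_ : \prod_s _ = 0) ?mul0r //.
case/splitPr: (mem_index_enum s) => l1 l2.
by rewrite big_cat big_cons /= ys p0 mul0r mulr0.
Qed.

(** There are [n - q] components, so flipping turns the label degree [\sum_s d s] into
    [2 * m * (n - q) - \sum_s d s]; the edges still contribute [(2 * m - 1) * q]. *)
Lemma kriz_flip_nf q k F y (d : 'I_n -> nat) :
    forest F -> size F = q -> supported gr F y d -> (forall s, d s <= 2 * m)%N ->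
    ((2 * m - 1) * q + \sum_s d s = k)%N ->
  bideg q (2 * m * n + 2 * q * (m - 1) - k) (nf pull edge F (flip_at m gr F y)).
Proof.
move=> fF sF supp dm <-.
have supp' := supported_flip pd supp dm.
(* A forest has no loops, and [kriz_monomial] only admits generators with distinct indices. *)
have Fne : {in F, forall e, e.1 != e.2}.
  elim: F fF {sF supp supp'} => //= e F IH /andP[re /IH Fe] f.
  by rewrite inE => /predU1P[->|/Fe//]; apply: contraNneq re => ->.
have sum_d : (\sum_s flip_deg m F d s + \sum_s d s
    = 2 * m * #|[set s | rep F s == s]|)%N.
  rewrite -big_split /= mulnC -sum_nat_const [RHS]big_mkcond /=.
  apply: eq_bigr => s _; rewrite inE /flip_deg; case: ifPn => rs; first by rewrite subnK.
  by rewrite (supp.2 s rs).2.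
have := card_rep fF; rewrite sF => card_n.
have -> : (2 * m * n + 2 * q * (m - 1) - ((2 * m - 1) * q + \sum_s d s)
   = (2 * m - 1) * size F + \sum_s flip_deg m F d s)%N.
  rewrite sF; nia.
by rewrite -{1}sF; apply/kriz_bideg_monomial/kriz_monomial_prod => //; case: supp'.
Qed.

(** As [flip] is an involution, [f] is one on normal forms of exterior degree [q], and both
    injectivity and surjectivity follow. *)
Lemma kriz_duality q k : (k <= 2 * m * n - q)%N -> (q <= n)%N ->
  equivariant_iso (@kriz_act m H gr n) (@kriz_act m H gr n)
    (bideg q k) (bideg q (2 * m * n + 2 * q * (m - 1) - k)).
Proof.
move=> kle qn; have [f f_nf] := flip_map_exists pd kriz_algebra_family q kriz_algebra_universal.
have f_bideg k' u : bideg q k' u -> bideg q (2 * m * n + 2 * q * (m - 1) - k') (f u).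
  elim/kriz_bideg_nf_ind=> [|v v' hv hv'|c v hv|F y d fF sF supp dm dk].
  - rewrite linear0; exact: kriz_bideg0.
  - rewrite linearD; exact: kriz_bidegD.
  - rewrite linearZZ; exact: kriz_bidegZ.
  - by rewrite f_nf // => [|s /supp.2[]//]; apply: kriz_flip_nf dk.
have fK k' u : bideg q k' u -> f (f u) = u.
  elim/kriz_bideg_nf_ind=> [|v v' hv hv'|c v hv|F y d fF sF supp dm dk].
  - by rewrite !linear0.
  - by rewrite !linearD /= hv hv'.
  - by rewrite !linearZZ /= hv.
  - have supp' := supported_flip pd supp dm.
    rewrite f_nf // => [|s /supp.2[]//]; rewrite f_nf // => [|s /supp'.2[]//].
    by rewrite (flip_atK pd).
exists f; split.
- by move=> c u v _ _; apply: linearP.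
- exact: f_bideg.
- by move=> u v uk vk fuv; rewrite -(fK _ _ uk) -(fK _ _ vk) fuv.
- move=> v vk; exists (f v); last exact: fK vk.
  (* The bound on [k] keeps it below [2 * m * n + 2 * q * (m - 1)], so the truncated subtraction
     applied twice gives [k] back. *)
  by have := f_bideg _ _ vk; rewrite subKn //; nia.
have fD (u v : A) : f (u + v) = f u + f v := linearD f u v.
have fZ c (u : A) : f (c *: u) = c *: f u := linearZZ f c u.
move=> s.
have aD (u v : A) : @kriz_act m H gr n s (u + v) = (kriz_act s u : A) + kriz_act s v.
  exact: (kriz_actD m_gt0 s u v).
have aZ c (u : A) : @kriz_act m H gr n s (c *: u) = c *: (kriz_act s u : A).
  exact: (kriz_actZ m_gt0 s c u).
move=> u.
elim/kriz_bideg_nf_ind=> [|v v' hv hv'|c v hv|F y d fF sF supp dm dk].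
- by rewrite linear0 (kriz_act0 gr m_gt0) linear0.
- rewrite aD fD fD aD; exact: (f_equal2 (fun a b : A => a + b) hv hv').
- rewrite aZ fZ fZ aZ; exact: (f_equal (fun a : A => c *: a) hv).
rewrite f_nf // => [|i /supp.2[]//].
apply: (flip_map_act pd kriz_algebra_family (A := kriz_act_rmorphism s) f_nf _ _ fF sF supp dm).
  by move=> i x; apply: kriz_act_pull.
by move=> i j; apply: kriz_act_G.
Qed.

End KrizAlgebra.

Theorem proposition2p2 (m : nat) (H : falgType rat) (gr : nat -> {vspace H})
    (w : H) (n q k : nat) :
  (1 <= m)%N -> poincare_duality_algebra m gr w ->
  (1 <= n)%N -> (q <= n - 1)%N ->
  ((2 * m - 1) * q <= k <= 2 * m * n - q)%N ->
  equivariant_iso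
    (@kriz_act m H gr n) (@kriz_act m H gr n)
    (@kriz_bideg m H gr n q k)
    (@kriz_bideg m H gr n q (2 * m * n + 2 * q * (m - 1) - k)%N).
Proof.
move=> m1 pd n1 qn /andP[_ kle].
(* If [1 = 0] in the model, every element is zero and the identity map serves. *)
have [E0|nz] := eqVneq (1 : quotient_algebra (@kriz_rel m H gr n)) 0; last first.
  by apply: (kriz_duality nz m1 pd) => //; lia.
have all0 (u : quotient_algebra (@kriz_rel m H gr n)) : u = 0.
  by rewrite -[u]mulr1 E0 mulr0.
exists id; split=> // [u _|v _]; first by rewrite (all0 u); apply: kriz_bideg0.
by exists 0; [apply: kriz_bideg0 | rewrite (all0 v)].
Qed.
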